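(* Assume that the penalty parameters satisfy $$\beta_{\ell}>L\,L_{\bar{\mathcal O}}\,\max\{\theta_w,1\}^{L}+2\sum_{j=\ell+1}^L\beta_j\,\theta_w\max\{\theta_w,1\}^{j-\ell-1}\quad\text{for all }\ell\in[L].$$ If $(w^*,b^*,v^*,u^* )\in\{(w,b,v,u)\in\Omega_2:\mathcal O(w,v,u)<\theta\}$ is a limiting stationary point of problem (PP), then $(w^*,b^*,v^*,u^* )$ is an MPCC W-stationary point of problem (P).
   Context: Setting. $[K]=\{1,\dots,K\}$; $\|\cdot\|$ is the Euclidean norm. $L,N,N_0,\dots,N_L$ are positive integers, $x_n\in\mathbb R^{N_0}$ and $y_n\in\mathbb R^{N_L}$ ($n\in[N]$) are given data, $Y=(y_1,\dots,y_N)$, and $0<\alpha<1$, $\lambda_w>0$, $\lambda_v>0$, $\beta_\ell>0$ ($\ell\in[L]$) are constants. $\sigma(z)=\max\{z,\alpha z\}$ componentwise. Variables. $W_\ell\in\mathbb R^{N_\ell\times N_{\ell-1}}$, $b_\ell\in\mathbb R^{N_\ell}$, $v_{n,\ell},u_{n,\ell}\in\mathbb R^{N_\ell}$ for $\ell\in[L]$, $n\in[N]$, with $v_{n,0}:=x_n$. Put $\widetilde N=\sum_{\ell=1}^LN_\ell N_{\ell-1}$, $\overline N=\sum_{\ell=1}^LN_\ell$, $m=N\overline N$. The vectors $w\in\mathbb R^{\widetilde N}$ (stacking the column-wise vectorizations of $W_1,\dots,W_L$), $b\in\mathbb R^{\overline N}$ (stacking $b_1,\dots,b_L$), and $v,u\in\mathbb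 R^m$ (stacking $v_{n,\ell}$, resp. $u_{n,\ell}$, in the order $(1,1),(2,1),\dots,(N,1),(1,2),\dots,(N,L)$ of $(n,\ell)$) collect the variables. The linear-in-$w$ map $\Psi(v)w$ and the matrix $A\in\mathbb R^{m\times\overline N}$ are such that $\Psi(v)w+Ab$ has $(n,\ell)$ block $W_\ell v_{n,\ell-1}+b_\ell$; that is, $\Psi(v)$ is block diagonal with blocks $V_{\ell-1}^\top\otimes I_{N_\ell}$, where $V_\ell=(v_{1,\ell},\dots,v_{N,\ell})$, $V_0=(x_1,\dots,x_N)$, and $A$ is block diagonal with blocks $e_N\otimes I_{N_\ell}$ ($e_K$ is the all-ones vector in $\mathbb R^K$). Objective. $\mathcal R_1(w)=\lambda_w\sum_{\ell=1}^L\sum_{j=1}^{N_{\ell-1}}\|(W_\ell)_{\cdot,j}\|$ (with $(W_\ell)_{\cdot,j}$ the $j$-th column), $\mathcal R_2(v)=\lambda_v\|v\|^2$, $\bar{\mathcal O}(w,v)=\frac1N\sum_{n=1}^N\|v_{n,L}-y_n\|^2+\mathcal R_1(w)+\mathcal R_2(v)$. With $\beta=(\beta_1e_{NN_1}^\top,\dots,\beta_Le_{NN_L}^\top)^\top\in\mathbb R^m$, $\mathcal O(w,v,u)=\bar{\mathcal O}(w,v)+\beta^\top(v-\sigma(u))$. Problem (P): minimize $\bar{\mathcal O}(w,v)$ over $\Omega_1=\{(w,b,v,u): v=\sigma(u),\ u=\Psi(v)w+Ab\}$. Problem (PP): minimize $\mathcal O(w,v,u)$ over $\Omega_2=\{(w,b,v,u):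 v-u\ge0,\ v-\alpha u\ge 0,\ u=\Psi(v)w+Ab\}$. Constants. $\theta>\frac1N\|Y\|_F^2$ is fixed; $\Omega_\theta=\{(w,b,v,u)\in\Omega_2:\mathcal O(w,v,u)\le\theta\}$; $\theta_w=\frac{\theta}{\lambda_w}\sqrt{\overline N+N_0}$ (an upper bound for $\|w\|$ on $\Omega_\theta$); $L_{\bar{\mathcal O}}$ is the Lipschitz constant of $\bar{\mathcal O}$ over $\Omega_\theta$. Limiting stationarity. A point $\bar z\in\mathcal Z$ is a limiting stationary point of $\min_{z\in\mathcal Z}f(z)$ if $0\in\partial f(\bar z)+\mathcal N_{\mathcal Z}(\bar z)$, with $\partial f$ the limiting (Mordukhovich) subdifferential and $\mathcal N_{\mathcal Z}$ the limiting normal cone. For (PP), $\mathcal O$ is regarded as a function of $(w,b,v,u)$. MPCC W-stationarity. $(w^*,b^*,v^*,u^* )\in\Omega_1$ is an MPCC W-stationary point of (P) if there exist $\mu^1,\mu^2,\xi\in\mathbb R^m$ such that $$0\in\partial\mathcal R_1(w^* )-\Psi(v^* )^\top\xi,\qquad 0=A^\top\xi,$$ $$0=\nabla_v\bar{\mathcal O}(w^*,v^* )-\mu^1-\mu^2-\nabla_v\big(\xi^\top\Psi(v)w^*\big)\big|_{v=v^*},\qquad 0=\mu^1+\alpha\mu^2+\xi,$$ $$(\mu^1)^\top(v^*-u^* )=0,\qquad(\mu^2)^\top(v^*-\alpha u^* )=0.$$ *)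

(* Defs.v *)
(* MathComp / MathComp-Analysis, with the Kronecker product [*t] of mxtens. *)
From mathcomp Require Import all_boot all_order all_algebra.
From mathcomp Require Import mxtens.
From mathcomp Require Import boolp classical_sets reals topology normedtype.
From mathcomp Require Import sequences derive.

Set Implicit Arguments.
Unset Strict Implicit.
Unset Printing Implicit Defensive.

Import Order.TTheory GRing.Theory Num.Theory.
Import numFieldNormedType.Exports.

Local Open Scope classical_set_scope.
Local Open Scope ring_scope.

(** * Limiting variational analysis in R^n *)

Section VariationalAnalysis.
Variable R : realType.

(* The library norm on matrices is the sup norm; this is the Frobenius norm,
   i.e. the Euclidean norm on column vectors.  Both induce the same topology,
   so the library's neighbourhoods and limits are used below. *)
Definition enorm (p q : nat) (A : 'M[R]_(p, q)) : R :=
  Num.sqrt (\sum_i \sum_j A i j ^+ 2).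

Definition dot (n : nat) (x y : 'cV[R]_n) : R := \sum_i x i 0 * y i 0.

Definition grad (n : nat) (f : 'cV[R]_n -> R) (x : 'cV[R]_n) : 'cV[R]_n :=
  \col_i ('D_(delta_mx i 0) f x : R).

(* f x' >= f x + <g, x' - x> + o(|x' - x|) *)
Definition regular_subdifferential (n : nat) (f : 'cV[R]_n -> R)
    (x : 'cV[R]_n) : set 'cV[R]_n :=
  [set g | forall e : R, 0 < e ->
    \forall x' \near x, f x + dot g (x' - x) - e * enorm (x' - x) <= f x'].

Definition limiting_subdifferential (n : nat) (f : 'cV[R]_n -> R)
    (x : 'cV[R]_n) : set 'cV[R]_n :=
  [set g | exists xk gk : nat -> 'cV[R]_n,
    [/\ xk @ \oo --> x, (fun k => f (xk k)) @ \oo --> f x,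
        forall k, regular_subdifferential f (xk k) (gk k)
      & gk @ \oo --> g]].

(* <g, x' - x> <= o(|x' - x|) for x' in Z *)
Definition regular_normal_cone (n : nat) (Z : set 'cV[R]_n)
    (x : 'cV[R]_n) : set 'cV[R]_n :=
  [set g | forall e : R, 0 < e ->
    \forall x' \near x, Z x' -> dot g (x' - x) <= e * enorm (x' - x)].

Definition limiting_normal_cone (n : nat) (Z : set 'cV[R]_n)
    (x : 'cV[R]_n) : set 'cV[R]_n :=
  [set g | exists xk gk : nat -> 'cV[R]_n,
    [/\ forall k, Z (xk k), xk @ \oo --> x,
        forall k, regular_normal_cone Z (xk k) (gk k)
      & gk @ \oo --> g]].

Definition limiting_stationary_point (n : nat) (f : 'cV[R]_n -> R)
    (Z : set 'cV[R]_n) (z : 'cV[R]_n) : Prop :=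
  Z z /\ exists g h : 'cV[R]_n,
    [/\ limiting_subdifferential f z g, limiting_normal_cone Z z h
      & 0 = g + h].

End VariationalAnalysis.

(** * The network *)

(* [d l] is the width N_l of layer l, for 0 <= l <= L.  A block index
   [l : 'I_L] stands for the layer l.+1 in 1..L. *)
Definition wdim (L : nat) (d : nat -> nat) : nat :=
  (\sum_(l < L) d l * d l.+1)%N.
Definition bdim (L : nat) (d : nat -> nat) : nat :=
  (\sum_(l < L) d l.+1)%N.
Definition vdim (L N : nat) (d : nat -> nat) : nat :=
  (\sum_(l < L) N * d l.+1)%N.
Definition zdim (L N : nat) (d : nat -> nat) : nat :=
  (wdim L d + (bdim L d + (vdim L N d + vdim L N d)))%N.

Section Network.
Variables (R : realType) (L N : nat) (d : nat -> nat).

Definition wpart (z : 'cV[R]_(zdim L N d)) : 'cV[R]_(wdim L d) := usubmx z.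
Definition bpart (z : 'cV[R]_(zdim L N d)) : 'cV[R]_(bdim L d) :=
  usubmx (dsubmx z).
Definition vpart (z : 'cV[R]_(zdim L N d)) : 'cV[R]_(vdim L N d) :=
  usubmx (dsubmx (dsubmx z)).
Definition upart (z : 'cV[R]_(zdim L N d)) : 'cV[R]_(vdim L N d) :=
  dsubmx (dsubmx (dsubmx z)).

(* [mxtens_index (j, i)] has value j * d l.+1 + i: the l-th block of w is the
   column-wise vectorization of the matrix W_{l+1}. *)
Definition weight (w : 'cV[R]_(wdim L d)) (l : 'I_L) : 'M[R]_(d l.+1, d l) :=
  \matrix_(i, j)
    @submxcol R L (fun k => d k * d k.+1)%N 1 w l (mxtens_index (j, i)) 0.

Definition bias (b : 'cV[R]_(bdim L d)) (l : 'I_L) : 'cV[R]_(d l.+1) :=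
  @submxcol R L (fun k => d k.+1) 1 b l.

(* The matrix with columns v_{1,l+1}, ..., v_{N,l+1}. *)
Definition block (v : 'cV[R]_(vdim L N d)) (l : 'I_L) : 'M[R]_(d l.+1, N) :=
  \matrix_(i, n)
    @submxcol R L (fun k => N * d k.+1)%N 1 v l (mxtens_index (n, i)) 0.

(* V_l for 0 <= l <= L, where V_0 = X has columns x_1, ..., x_N. *)
Definition layer (X : 'M[R]_(d 0%N, N)) (v : 'cV[R]_(vdim L N d)) (l : nat) :
    (l <= L)%N -> 'M[R]_(d l, N) :=
  match l with
  | 0%N => fun _ => X
  | k.+1 => fun lt_kL : (k < L)%N => block v (Ordinal lt_kL)
  end.

(* As in [mxdiag], [conform_mx 0] is only the identification of the diagonal
   block, of size (N * d l.+1, d l * d l.+1), with the type required at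
   position (l, k) when l = k; see [preactivationE]. *)
Definition Psi (X : 'M[R]_(d 0%N, N)) (v : 'cV[R]_(vdim L N d)) :
    'M[R]_(vdim L N d, wdim L d) :=
  \mxblock_(l < L, k < L)
    (if l == k then
       conform_mx (0 : 'M[R]_(N * d l.+1, d k * d k.+1))
         ((layer X v (ltnW (ltn_ord l)))^T *t (1%:M : 'M[R]_(d l.+1)))
     else 0).

Definition Amx : 'M[R]_(vdim L N d, bdim L d) :=
  \mxblock_(l < L, k < L)
    (if l == k then
       conform_mx (0 : 'M[R]_(N * d l.+1, d k.+1))
         ((const_mx 1 : 'cV[R]_N) *t (1%:M : 'M[R]_(d l.+1)))
     else 0).

Definition sigma (alpha : R) (u : 'cV[R]_(vdim L N d)) :
    'cV[R]_(vdim L N d) :=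
  map_mx (fun t => Num.max t (alpha * t)) u.

Definition beta_vec (beta : 'I_L -> R) : 'cV[R]_(vdim L N d) :=
  \mxcol_(l < L) (const_mx (beta l) : 'cV[R]_(N * d l.+1)).

Definition R1 (lambda_w : R) (w : 'cV[R]_(wdim L d)) : R :=
  lambda_w * \sum_(l < L) \sum_(j < d l) enorm (col j (weight w l)).

Definition R2 (lambda_v : R) (v : 'cV[R]_(vdim L N d)) : R :=
  lambda_v * enorm v ^+ 2.

Definition Obar (X : 'M[R]_(d 0%N, N)) (Y : 'M[R]_(d L, N))
    (lambda_w lambda_v : R)
    (w : 'cV[R]_(wdim L d)) (v : 'cV[R]_(vdim L N d)) : R :=
  N%:R^-1 * (\sum_(n < N) enorm (col n (layer X v (leqnn L)) - col n Y) ^+ 2)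
  + R1 lambda_w w + R2 lambda_v v.

Definition Opp (X : 'M[R]_(d 0%N, N)) (Y : 'M[R]_(d L, N))
    (alpha lambda_w lambda_v : R) (beta : 'I_L -> R)
    (w : 'cV[R]_(wdim L d)) (v u : 'cV[R]_(vdim L N d)) : R :=
  Obar X Y lambda_w lambda_v w v + dot (beta_vec beta) (v - sigma alpha u).

Definition Omega1 (X : 'M[R]_(d 0%N, N)) (alpha : R) :
    set 'cV[R]_(zdim L N d) :=
  [set z | vpart z = sigma alpha (upart z) /\
           upart z = Psi X (vpart z) *m wpart z + Amx *m bpart z].

Definition Omega2 (X : 'M[R]_(d 0%N, N)) (alpha : R) :
    set 'cV[R]_(zdim L N d) :=
  [set z | [/\ forall i, 0 <= (vpart z - upart z) i 0,
               forall i, 0 <= (vpart z - alpha *: upart z) i 0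
             & upart z = Psi X (vpart z) *m wpart z + Amx *m bpart z]].

Definition Omega_theta (X : 'M[R]_(d 0%N, N)) (Y : 'M[R]_(d L, N))
    (alpha lambda_w lambda_v : R) (beta : 'I_L -> R) (theta : R) :
    set 'cV[R]_(zdim L N d) :=
  [set z | Omega2 X alpha z /\
     Opp X Y alpha lambda_w lambda_v beta (wpart z) (vpart z) (upart z)
       <= theta].

Definition theta_w (lambda_w theta : R) : R :=
  theta / lambda_w * Num.sqrt (bdim L d + d 0)%N%:R.

(* [f] depends on (w, v) only, so increments are measured in the Euclidean
   norm of (w, v). *)
Definition lipschitz_constant (Z : set 'cV[R]_(zdim L N d))
    (f : 'cV[R]_(wdim L d) -> 'cV[R]_(vdim L N d) -> R) (K : R) : Prop :=
  0 <= K /\ forall z z', Z z -> Z z' ->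
    `|f (wpart z) (vpart z) - f (wpart z') (vpart z')|
      <= K * enorm (col_mx (wpart z) (vpart z) - col_mx (wpart z') (vpart z')).

Definition MPCC_W_stationary (X : 'M[R]_(d 0%N, N)) (Y : 'M[R]_(d L, N))
    (alpha lambda_w lambda_v : R) (z : 'cV[R]_(zdim L N d)) : Prop :=
  let w := wpart z in let v := vpart z in let u := upart z in
  Omega1 X alpha z /\
  exists mu1 mu2 xi : 'cV[R]_(vdim L N d),
    [/\ exists2 g, limiting_subdifferential (R1 lambda_w) w g
                 & 0 = g - (Psi X v)^T *m xi,
        0 = Amx^T *m xi,
        0 = grad (Obar X Y lambda_w lambda_v w) v - mu1 - mu2
            - grad (fun v' => dot xi (Psi X v' *m w)) v,
        0 = mu1 + alpha *: mu2 + xi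
      & dot mu1 (v - u) = 0 /\ dot mu2 (v - alpha *: u) = 0].

Lemma submxcol_mulmx (p q : 'I_L -> nat)
    (B : forall l k, 'M[R]_(p l, q k)) (c : 'cV[R]_(\sum_k q k)) (l : 'I_L) :
  (forall k, k != l -> B l k = 0) ->
  submxcol (\mxblock_(l, k) B l k *m c) l = B l l *m submxcol c l.
Proof.
move=> B0; rewrite -[c]submxcolK mul_mxblock_mxrow !mxcolK (bigD1 l) //=.
by rewrite big1 ?addr0 // => k /B0 ->; rewrite mul0mx.
Qed.

Lemma preactivationE (X : 'M[R]_(d 0%N, N)) (v : 'cV[R]_(vdim L N d))
    (w : 'cV[R]_(wdim L d)) (b : 'cV[R]_(bdim L d)) (l : 'I_L) (n : 'I_N) :
  col n (block (Psi X v *m w + Amx *m b) l) =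
  weight w l *m col n (layer X v (ltnW (ltn_ord l))) + bias b l.
Proof.
apply/colP => i; rewrite 2![LHS]mxE submxcolD [LHS]mxE [RHS]mxE.
congr (_ + _).
  rewrite /Psi submxcol_mulmx; last by move=> k /negPf; rewrite eq_sym => ->.
  rewrite eqxx conform_mx_id [LHS]mxE [RHS]mxE.
  rewrite (reindex (@mxtens_index _ _)) /=; last first.
    by exists (@mxtens_unindex _ _) => ? _;
      rewrite ?mxtens_indexK ?mxtens_unindexK.
  transitivity (\sum_j \sum_k
      (layer X v (ltnW (ltn_ord l)))^T n j * (1%:M : 'M_(d l.+1)) i k *
      @submxcol R L (fun k => d k * d k.+1)%N 1 w l (mxtens_index (j, k)) 0).
    by rewrite pair_bigA /=; apply: eq_bigr => -[j k] _ /=; rewrite tensmxE.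
  apply: eq_bigr => j _; rewrite (bigD1 i) //= big1 ?addr0 => [|k ki].
    by rewrite [weight _ _ _ _]mxE [col _ _ _ _]mxE [_^T _ _]mxE [1%:M _ _]mxE
        eqxx mulr1 mulrC.
  by rewrite [1%:M _ _]mxE eq_sym (negPf ki) mulr0 mul0r.
rewrite /Amx submxcol_mulmx; last by move=> k /negPf; rewrite eq_sym => ->.
rewrite eqxx -(conform_castmx (erefl, mul1n (d l.+1))) conform_mx_id [LHS]mxE.
rewrite (bigD1 i) //= big1 ?addr0 => [|k ki]; rewrite castmxE /=.
  set j := cast_ord _ i.
  have -> : j = mxtens_index (ord0 : 'I_1, i) by apply: val_inj.
  by rewrite cast_ord_id tensmxE [const_mx _ _ _]mxE [1%:M _ _]mxE eqxx !mul1r.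
set j := cast_ord _ k.
have -> : j = mxtens_index (ord0 : 'I_1, k) by apply: val_inj.
by rewrite cast_ord_id tensmxE [1%:M _ _]mxE eq_sym (negPf ki) mulr0 mul0r.
Qed.

End Network.

Arguments Amx {R L N d}.

(* Main.v *)
Require Import Defs.
From mathcomp Require Import all_boot all_order all_algebra.
From mathcomp Require Import mxtens.
From mathcomp Require Import boolp classical_sets functions filter reals.
From mathcomp Require Import topology normedtype.
From mathcomp Require Import sequences derive realfun ring lra.

(** The lifted feasible set is cut out by affine inequalities
    [v - u >= 0], [v - alpha u >= 0] and by the bilinear equation
    [u = Psi(v) w + A b].  Three ideas give the theorem.

    Multipliers.  A regular normal to a set [G >= 0, H = 0] is described by
    minimizing the linear form it defines, tilted by a small norm and penalized
    by the squared infeasibility, over a small ball: the derivative of the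
    penalty at the minimizer is a combination of gradients of [G] and [H], with
    [mu >= 0] on the violated inequalities ([penalty_multipliers]).  Passing to
    the limit needs compactness of the multipliers, which follows, after
    normalization, from a constraint qualification
    ([limiting_normal_multipliers]).  The qualification holds here because of
    the layered structure: for fixed weights, the increment of [u] depends
    linearly on that of the preceding layer of [v], so a forward recursion
    produces a direction with [dv = |du| + 1], which strictly increases every
    slack
    ([exists_response_fixpoint], [no_nonzero_abnormal_multiplier]).

    Exactness of the penalty.  Suppose that some neuron of layer [l] satisfies
    [v > sigma(u)].  Decrease [v] there at unit speed and propagate forward by
    [dv = |du|] in the later layers.  The weights being fixed, this is a
    straight segment inside the feasible set, so that the Lipschitz constant
    bounds the slope of the unpenalized objective by [LO * enorm dv].  On the
    sublevel set the entrywise 1-norm of [W x] is at most [theta_w] times that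
    of [x]; hence [enorm dv <= L max(theta_w, 1)^L], and a limiting subgradient
    of the penalty [beta (v - sigma(u))] pairs with this direction to at most
    [2 sum_(j > l) beta_j theta_w max(theta_w, 1)^(j-l-1) - beta_l].  The lower
    bound imposed on [beta_l] makes the total slope negative, while
    stationarity makes it nonnegative ([stationary_active]).

    Translation of the multipliers.  The penalty contributes [beta] to the
    [v]-component of a limiting subgradient, and [- beta] or [- alpha beta] to
    each entry of its [u]-component, according to the branch of the leaky
    activation that is selected ([limiting_subgradient]).  Subtracting [beta]
    from [mu1] or from [mu2], according to the branch, absorbs both
    contributions; complementarity survives since [v = sigma(u)].  The
    subtraction may destroy the sign of the multipliers, so that the conclusion
    is W-stationarity. *)

Set Implicit Arguments.
Unset Strict Implicit.
Unset Printing Implicit Defensive.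

Import Order.TTheory GRing.Theory Num.Theory.
Import numFieldNormedType.Exports.
Local Open Scope classical_set_scope.
Local Open Scope ring_scope.

(** * Euclidean norms and limits of matrices *)

Section Norms.
Variable R : realType.

Lemma enorm_ge0 p q (A : 'M[R]_(p, q)) : 0 <= enorm A.
Proof. exact: sqrtr_ge0. Qed.

Lemma enormZ p q (c : R) (A : 'M[R]_(p, q)) :
  enorm (c *: A) = `|c| * enorm A.
Proof.
rewrite /enorm -sqrtr_sqr -sqrtrM ?sqr_ge0 //; congr Num.sqrt.
rewrite mulr_sumr; apply: eq_bigr => i _; rewrite mulr_sumr.
by apply: eq_bigr => j _; rewrite mxE exprMn.
Qed.

Lemma sumr_sqr_le (I : finType) (F : I -> R) :
  (forall i, 0 <= F i) -> \sum_i F i ^+ 2 <= (\sum_i F i) ^+ 2.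
Proof.
move=> F0; rewrite expr2 mulr_suml ler_sum // => i _; rewrite expr2.
by apply: ler_wpM2l => //; rewrite (bigD1 i) //= lerDl sumr_ge0.
Qed.

(** Summing [F i * F j <= (F i ^+ 2 + F j ^+ 2) / 2] over all pairs. *)
Lemma sqr_sumr_le (I : finType) (F : I -> R) :
  (\sum_i F i) ^+ 2 <= #|I|%:R * \sum_i F i ^+ 2.
Proof.
have ->: (\sum_i F i) ^+ 2 = \sum_i \sum_j F i * F j.
  by rewrite expr2 mulr_suml; apply: eq_bigr => i _; rewrite mulr_sumr.
have le2 (i j : I) : F i * F j <= (F i ^+ 2 + F j ^+ 2) / 2.
  by have := sqr_ge0 (F i - F j); nra.
set S := \sum_i F i ^+ 2.
have -> : #|I|%:R * S = \sum_i \sum_j ((F i ^+ 2 + F j ^+ 2) / 2).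
  transitivity (\sum_i ((#|I|%:R * F i ^+ 2 + S) / 2)).
    rewrite -mulr_suml big_split /= -mulr_sumr -/S sumr_const.
    rewrite -[S *+ _]mulr_natl. by field.
  apply: eq_bigr => i _; rewrite -mulr_suml big_split /= -/S sumr_const.
  by rewrite -[F i ^+ 2 *+ _]mulr_natl.
by apply: ler_sum => i _; apply: ler_sum => j _.
Qed.

Lemma enorm_le_sum n (x : 'cV[R]_n) : enorm x <= \sum_i `|x i 0|.
Proof.
have s0 : 0 <= \sum_i `|x i 0| by exact: sumr_ge0.
rewrite -(ger0_norm s0) -sqrtr_sqr ler_wsqrtr //.
under eq_bigr do rewrite big_ord1 -real_normK ?num_real //.
exact: sumr_sqr_le.
Qed.

Lemma sum_le_enorm n (x : 'cV[R]_n) :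
  \sum_i `|x i 0| <= Num.sqrt n%:R * enorm x.
Proof.
have s0 : 0 <= \sum_i `|x i 0| by exact: sumr_ge0.
rewrite -[leLHS](ger0_norm s0) -sqrtr_sqr -sqrtrM ?ler0n // ler_wsqrtr //.
under [X in _ <= _ * X]eq_bigr do rewrite big_ord1 -real_normK ?num_real //.
by have := sqr_sumr_le (fun i => `|x i 0|); rewrite card_ord.
Qed.

Lemma le_mx_norm p q (A : 'M[R]_(p, q)) i j : `|A i j| <= `|A|.
Proof.
rewrite [leRHS]/Num.Def.normr /= mx_normrE.
by apply/bigmax_geP; right => /=; exists (i, j).
Qed.

Lemma enorm_le_mx_norm n (x : 'cV[R]_n) : enorm x <= n%:R * `|x|.
Proof.
apply: le_trans (enorm_le_sum x) _.
rewrite -[n in n%:R]card_ord mulr_natl -sumr_const.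
by apply: ler_sum => i _; exact: le_mx_norm.
Qed.

Lemma cvg_sumr (I : finType) T (F : set_system T) {FF : Filter F}
    (f : I -> T -> R) (l : I -> R) :
  (forall i, f i @ F --> l i) -> \sum_i f i x @[x --> F] --> \sum_i l i.
Proof. by move=> fl; apply: cvg_big => //; exact: add_continuous. Qed.

Lemma enorm_continuous p q : continuous (@enorm R p q).
Proof.
move=> A; apply: continuous_comp; last exact: sqrt_continuous.
apply: (@cvg_sumr _ _ (nbhs A)) => i.
apply: (@cvg_sumr _ _ (nbhs A)) => j.
by apply: cvgM; exact: coord_continuous.
Qed.

Lemma cvg_mx T (F : set_system T) {FF : Filter F} p q
    (f : T -> 'M[R]_(p, q)) (A : 'M[R]_(p, q)) :
  (forall i j, f x i j @[x --> F] --> A i j) -> f @ F --> A.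
Proof.
move=> fA; apply/cvg_mx_entourageP => E entE.
apply: filter_forall => i; apply: filter_forall => j.
have /cvg_entourageP/(_ _ entE) := fA i j.
by rewrite !near_map; apply: filterS => x Ex; exact: mem_set.
Qed.

Lemma cvg_coord T (F : set_system T) {FF : Filter F} p q
    (f : T -> 'M[R]_(p, q)) (A : 'M[R]_(p, q)) i j :
  f @ F --> A -> f x i j @[x --> F] --> A i j.
Proof.
move=> fA.
exact: (cvg_comp f (fun M : 'M[R]_(p, q) => M i j) fA
  (@coord_continuous _ _ _ i j A)).
Qed.

(** Closed balls of the sup norm are boxes; compactness of boxes is transferred
    from row vectors by transposition. *)
Lemma compact_box n (x : 'cV[R]_n) r : compact [set y | `|y - x| <= r].
Proof.
pose B := [set v : 'rV[R]_n | forall i, `[x i 0 - r, x i 0 + r]%classic (v ord0 i)].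
have cB : compact B.
  by apply: (@rV_compact _ _ (fun i => `[x i 0 - r, x i 0 + r]%classic)) => i;
    exact: segment_compact.
have ct : {within B, continuous (fun v : 'rV[R]_n => v^T)}.
  apply: continuous_subspaceT => v; apply: (@cvg_mx _ (nbhs v)) => i j.
  under eq_fun do rewrite mxE.
  by rewrite mxE; exact: coord_continuous.
have cK := continuous_compact ct cB; apply: (subclosed_compact _ cK).
  have -> : [set y | `|y - x| <= r] = (fun y => `|y - x|) @^-1` [set t | t <= r].
    by [].
  apply: closed_comp; last exact: closed_le.
  move=> y _; apply: (@cvg_norm _ _ _ (nbhs y)).
  by apply: cvgB; [exact: cvg_id|exact: cvg_cst].
move=> y /= yr; exists y^T; last by rewrite trmxK.
move=> i /=; rewrite mxE in_itv /= -ler_distl.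
by apply: le_trans yr; have := le_mx_norm (y - x) i 0; rewrite !mxE.
Qed.

End Norms.

(** * Multipliers from a quadratic penalty *)

Section DirectionalSlopes.
Variable R : realType.

Lemma derivable_right_slope n (f : 'cV[R]_n -> R) (x v : 'cV[R]_n) :
  derivable f x v ->
  t^-1 * (f (x + t *: v) - f x) @[t --> 0^'+] --> ('D_v f x : R).
Proof.
move=> df; have -> : (fun t => t^-1 * (f (x + t *: v) - f x)) =
    (fun t => t^-1 *: ((f \o shift x) (t *: v) - f x)).
  by apply/funext => t /=; rewrite [t *: v + x]addrC.
exact: cvg_dnbhs_at_right df.
Qed.

Lemma dotD n (a x y : 'cV[R]_n) : dot a (x + y) = dot a x + dot a y.
Proof.
by rewrite /dot -big_split; apply: eq_bigr => i _; rewrite !mxE mulrDr.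
Qed.

Lemma dotZ n c (a x : 'cV[R]_n) : dot a (c *: x) = c * dot a x.
Proof.
by rewrite /dot mulr_sumr; apply: eq_bigr => i _; rewrite !mxE mulrCA.
Qed.

Lemma dot0 n (a : 'cV[R]_n) : dot a 0 = 0.
Proof. by rewrite -(scale0r (0 : 'cV_n)) dotZ mul0r. Qed.

Lemma dotN n (a x : 'cV[R]_n) : dot a (- x) = - dot a x.
Proof. by rewrite -scaleN1r dotZ mulN1r. Qed.

Lemma cvg_dot n T (F : set_system T) {FF : Filter F}
    (f g : T -> 'cV[R]_n) (a b : 'cV[R]_n) :
  f @ F --> a -> g @ F --> b -> dot (f x) (g x) @[x --> F] --> dot a b.
Proof.
move=> fa gb; apply: cvg_sumr => i.
by apply: cvgM; exact: cvg_coord.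
Qed.

End DirectionalSlopes.

Section Multipliers.
Variables (R : realType) (n : nat) (I J : finType).
Variables (G : I -> 'cV[R]_n -> R) (H : J -> 'cV[R]_n -> R).

Definition feasible_set : set 'cV[R]_n :=
  [set z | (forall i, 0 <= G i z) /\ forall j, H j z = 0].

(** The pairing of [d] with the normal vector
    [\sum_j xi j * grad (H j) - \sum_i mu i * grad (G i)], written with
    directional derivatives so that no gradient needs to be formed. *)
Definition multiplier_form (mu : I -> R) (xi : J -> R) (z d : 'cV[R]_n) : R :=
  \sum_j xi j * 'D_d (H j) z - \sum_i mu i * 'D_d (G i) z.

Definition infeasibility (z : 'cV[R]_n) : R :=
  \sum_i Num.min 0 (G i z) ^+ 2 + \sum_j H j z ^+ 2.

Hypothesis G_continuous : forall i, continuous (G i).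
Hypothesis H_continuous : forall j, continuous (H j).

Lemma infeasibility_ge0 z : 0 <= infeasibility z.
Proof. by apply: addr_ge0; apply: sumr_ge0 => *; exact: sqr_ge0. Qed.

Lemma infeasibility_eq0 z : infeasibility z = 0 -> feasible_set z.
Proof.
move=> /eqP; rewrite paddr_eq0; try by apply: sumr_ge0 => *; exact: sqr_ge0.
rewrite !psumr_eq0 => [/andP[/allP G0 /allP H0]|*|*]; try exact: sqr_ge0.
split=> [i|j].
  have /implyP/(_ isT) := G0 i (mem_index_enum _).
  by rewrite sqrf_eq0 => /eqP m0; rewrite -m0 ge_min lexx orbT.
by have /implyP/(_ isT) := H0 j (mem_index_enum _); rewrite sqrf_eq0 => /eqP.
Qed.

Lemma feasible_infeasibility z : feasible_set z -> infeasibility z = 0.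
Proof.
move=> [G0 H0]; rewrite /infeasibility !big1 ?addr0 // => [j _|i _].
  by rewrite H0 expr0n.
by rewrite min_l // expr0n.
Qed.

Lemma infeasibility_continuous : continuous infeasibility.
Proof.
have csqr (f : 'cV[R]_n -> R) : continuous f -> continuous (fun z => f z ^+ 2).
  move=> cf z; apply: (cvg_comp f (fun t : R => t ^+ 2) (cf z)).
  exact: exprn_continuous.
move=> z; apply: (@cvgD _ _ _ (nbhs z)).
  apply: (@cvg_sumr R I _ (nbhs z)) => i; apply: csqr => {}z.
  apply: (@continuous_min R _ (fun=> 0) (G i) z); last exact: G_continuous.
  exact: (@cst_continuous _ R).
by apply: (@cvg_sumr R J _ (nbhs z)) => j; apply: csqr.
Qed.

(** The tilt [e * `|z - z0|] turns the approximate maximality of [z0] expressed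
    by a regular normal [h] into a strict minimality. *)
Definition penalized (z0 h : 'cV[R]_n) (e : R) (k : nat) (z : 'cV[R]_n) : R :=
  - dot h (z - z0) + e * `|z - z0| + k%:R * infeasibility z.

Lemma penalized_continuous z0 h e k : continuous (penalized z0 h e k).
Proof.
move=> z; have cz : y - z0 @[y --> z] --> z - z0.
  by apply: (@cvgB _ _ _ (nbhs z)); [exact: cvg_id|exact: cvg_cst].
apply: (@cvgD _ _ _ (nbhs z)); first apply: (@cvgD _ _ _ (nbhs z)).
- apply: (@cvgN _ _ _ (nbhs z)); apply: (@cvg_dot R n _ (nbhs z)) => //.
  exact: cvg_cst.
- by apply: (@cvgM _ _ (nbhs z)); [exact: cvg_cst|exact: cvg_norm].
- by apply: (@cvgM _ _ (nbhs z)); [exact: cvg_cst|exact: infeasibility_continuous].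
Qed.

(** Over a closed ball around [z0] the minimum of the penalized function is at
    most its value [0] at [z0].  On the boundary sphere, for a large penalty
    weight, the function is positive: where the point is infeasible the penalty
    wins, and where it is feasible the tilt dominates the linear form, [h] being
    a regular normal.  Compactness of the sphere makes one weight suffice, and
    then the minimizer is interior. *)
Lemma penalized_local_min z0 h e : feasible_set z0 ->
  regular_normal_cone feasible_set z0 h -> 0 < e ->
  exists k z, `|z - z0| < e /\
    \forall y \near z, penalized z0 h e k z <= penalized z0 h e k y.
Proof.
move=> fz0 hz0 e0.
have n0 : 0 < n.+1%:R :> R by rewrite ltr0n.
(* [enorm] is at most [n] times the sup norm; [n.+1] avoids dividing by 0. *)
pose e' := e / n.+1%:R / 2; have e'0 : 0 < e' by rewrite !divr_gt0.
have /nbhs_normP[r0 /= r00 hr0] := hz0 _ e'0.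
pose r := Num.min (r0 / 2) (e / 2).
have r_gt0 : 0 < r by rewrite lt_min !divr_gt0.
have hr y : feasible_set y -> `|y - z0| <= r ->
    dot h (y - z0) <= e / 2 * `|y - z0|.
  move=> fy yr; have yr0 : `|y - z0| < r0.
    by apply: le_lt_trans yr _; rewrite gt_min ltr_pdivrMr // ltr_pMr // ltr1n.
  have := hr0 y; rewrite /= distrC => /(_ yr0 fy) /le_trans; apply.
  apply: (@le_trans _ _ (e' * (n%:R * `|y - z0|))).
    by rewrite ler_wpM2l ?enorm_le_mx_norm // ltW.
  apply: (@le_trans _ _ (e' * (n.+1%:R * `|y - z0|))).
    by rewrite ler_pM2l //; apply: ler_wpM2r => //; rewrite ler_nat.
  by rewrite le_eqVlt; apply/orP; left; apply/eqP; rewrite /e'; field; lra.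
pose S := [set y : 'cV[R]_n | `|y - z0| <= r] `&` [set y | r <= `|y - z0|].
have cS : compact S.
  apply: (subclosed_compact _ (@compact_box _ _ z0 r)) => [|y []//].
  have cn : continuous (fun y : 'cV[R]_n => `|y - z0|).
    move=> y; apply: (@cvg_norm _ _ _ (nbhs y)).
    by apply: cvgB; [exact: cvg_id|exact: cvg_cst].
  apply: closedI.
    apply: (preimage_closed (f := fun y : 'cV[R]_n => `|y - z0|)
      (D := [set t | t <= r])) => [y _|]; [exact: cn|exact: closed_le].
  apply: (preimage_closed (f := fun y : 'cV[R]_n => `|y - z0|)
    (D := [set t | r <= t])) => [y _|]; [exact: cn|exact: closed_ge].
have mono k k' y : (k <= k')%N -> penalized z0 h e k y <= penalized z0 h e k' y.
  move=> kk; rewrite lerD2l; apply: ler_wpM2r; first exact: infeasibility_ge0.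
  by rewrite ler_nat.
have [k _ Sk] : \forall k \near \oo, S `<=` [set y | 0 < penalized z0 h e k y].
  have /compact_near_coveringP := cS.
  apply => y [/= yr ry].
  have [k yk] : exists k, 0 < penalized z0 h e k y.
    have [py|py0] := ltP 0 (infeasibility y).
      pose a := - dot h (y - z0) + e * `|y - z0|.
      exists (Num.truncn (`|a| / infeasibility y)).+1.
      rewrite /penalized -/a -ltrBlDl add0r.
      apply: (@le_lt_trans _ _ `|a|); first by rewrite -normrN ler_norm.
      by rewrite -ltr_pdivrMr // truncnS_gt.
    have fy : feasible_set y.
      by apply: infeasibility_eq0; apply/eqP; rewrite eq_le py0 infeasibility_ge0.
    exists 0%N; rewrite /penalized mul0r addr0.
    have := hr _ fy yr; have : 0 < e * `|y - z0|.
      by rewrite mulr_gt0 // (lt_le_trans r_gt0).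
    by lra.
  have := @penalized_continuous z0 h e k y.
  move=> /cvgrPdist_lt/(_ _ yk) yk'.
  exists ([set x | 0 < penalized z0 h e k x], [set k' | (k <= k')%N]).
    split => /=; last exact: nbhs_infty_ge.
    by apply: filterS yk' => x; rewrite ltr_distlC => /andP[]; rewrite subrr.
  move=> [x k'] /= [xk kk']; exact: lt_le_trans xk (mono _ _ _ kk').
have /(_ k (leqnn k)) Skk := Sk.
pose K := [set y : 'cV[R]_n | `|y - z0| <= r].
have Kz0 : K z0 by rewrite /K /= subrr normr0 ltW.
have [|z Kz zmin] := @compact_EVT_min _ _ (penalized z0 h e k) K (ex_intro _ z0 Kz0)
    (@compact_box _ _ z0 r).
  exact/continuous_subspaceT/penalized_continuous.
have {}Kz : `|z - z0| <= r by move: Kz; rewrite inE.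
have z_le0 : penalized z0 h e k z <= 0.
  have := zmin z0; rewrite inE => /(_ Kz0) /le_trans; apply.
  by rewrite /penalized subrr dot0 normr0 feasible_infeasibility // oppr0 !mulr0
    !addr0.
have zr : `|z - z0| < r.
  rewrite ltNge; apply/negP => rz.
  by have /= := Skk z (conj Kz rz); rewrite ltNge z_le0.
exists k, z; split.
  have re : r <= e / 2 by rewrite ge_min lexx orbT.
  by lra.
have dr : 0 < r - `|z - z0| by rewrite subr_gt0.
apply/nbhs_normP; exists (r - `|z - z0|) => //= y /= yz.
apply: zmin; rewrite inE /K /=; have := ler_distD z y z0.
by rewrite [`|y - z|]distrC; lra.
Qed.

(** The right-hand side is [(min 0 x + y) ^+ 2]: the squared negative part has
    a quadratic upper model at every point, which is all that an optimality
    condition for a minimum requires. *)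
Lemma min0_sqrD_le (x y : R) :
  Num.min 0 (x + y) ^+ 2 <= Num.min 0 x ^+ 2 + 2 * Num.min 0 x * y + y ^+ 2.
Proof.
have -> : Num.min 0 x ^+ 2 + 2 * Num.min 0 x * y + y ^+ 2 =
  (Num.min 0 x + y) ^+ 2 by ring.
by case: (leP 0 (x + y)) => xy; case: (leP 0 x) => x0; nra.
Qed.

Hypothesis G_derivable : forall i z d, derivable (G i) z d.
Hypothesis H_derivable : forall j z d, derivable (H j) z d.

(** First-order condition at the interior minimizer of the penalized function:
    [- 2 k min 0 (G i z)] and [2 k H j z] are the multipliers. *)
Lemma penalty_multipliers z0 h e : feasible_set z0 ->
  regular_normal_cone feasible_set z0 h -> 0 < e ->
  exists z mu xi, [/\ `|z - z0| < e, forall i, 0 <= mu i,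
    forall i, 0 < mu i -> G i z < 0
    & forall d, dot h d <= multiplier_form mu xi z d + e * `|d|].
Proof.
move=> fz0 hz0 e0; have [k [z [ze zmin]]] := penalized_local_min fz0 hz0 e0.
pose m i := Num.min 0 (G i z).
exists z, (fun i => - (2 * k%:R * m i)), (fun j => 2 * k%:R * H j z); split => //.
- move=> i; rewrite oppr_ge0 mulr_ge0_le0 ?mulr_ge0 ?ler0n //.
  by rewrite ge_min lexx.
- move=> i; rewrite oppr_gt0; apply: contraTT; rewrite -leNgt => G0.
  by rewrite /m min_l // mulr0 ltxx.
move=> d; pose DG i t := t^-1 * (G i (z + t *: d) - G i z).
pose DH j t := t^-1 * (H j (z + t *: d) - H j z).
pose q t := - dot h d + e * `|d| + k%:R *
  (\sum_i (2 * m i * DG i t + t * (DG i t * DG i t)) +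
   \sum_j (2 * H j z * DH j t + t * (DH j t * DH j t))).
have t_cvg : (t : R) @[t --> 0^'+] --> (0 : R).
  exact: cvg_at_right_filter cvg_id.
have sum_cvg (K : finType) (D : K -> R -> R) (a l : K -> R) :
    (forall i, D i t @[t --> 0^'+] --> l i) ->
    \sum_i (a i * D i t + t * (D i t * D i t)) @[t --> 0^'+] --> \sum_i a i * l i.
  move=> Dl; apply: cvg_sumr => i; rewrite -[a i * l i]addr0.
  apply: cvgD; first by apply: cvgM => //; exact: cvg_cst.
  rewrite -[X in _ --> X](mul0r (l i * l i)).
  by apply: cvgM => //; apply: cvgM.
have q_cvg : q t @[t --> 0^'+] --> - dot h d + e * `|d| + k%:R *
    (\sum_i 2 * m i * 'D_d (G i) z + \sum_j 2 * H j z * 'D_d (H j) z).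
  apply: cvgD; first exact: cvg_cst.
  apply: cvgM; first exact: cvg_cst.
  by apply: cvgD; apply: sum_cvg => i; exact: derivable_right_slope.
have : 0 <= - dot h d + e * `|d| + k%:R *
    (\sum_i 2 * m i * 'D_d (G i) z + \sum_j 2 * H j z * 'D_d (H j) z).
  apply: (cvgr_to_ge q_cvg).
  have line_cvg : z + t *: d @[t --> 0^'+] --> z.
    apply: cvg_at_right_filter; rewrite -[X in _ --> X]addr0 -(scale0r d).
    apply: cvgD; first exact: cvg_cst.
    by apply: cvgZ; [exact: cvg_id|exact: cvg_cst].
  have zline : \forall t \near 0^'+,
      penalized z0 h e k z <= penalized z0 h e k (z + t *: d).
    exact: line_cvg _ zmin.
  move: (nbhs_right_gt (0 : R)) zline; apply: filterS2 => t t0 zt.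
  rewrite -(pmulr_rge0 _ t0).
  have dq D x y : D = t^-1 * (y - x) -> y = x + t * D.
    by move=> ->; field; rewrite gt_eqF.
  move: zt; rewrite /penalized [z + t *: d - z0]addrAC.
  rewrite [dot h (_ + _ *: _)]dotD dotZ.
  have nle : `|z - z0 + t *: d| <= `|z - z0| + t * `|d|.
    by rewrite (le_trans (ler_normD _ _)) // normrZ gtr0_norm.
  have infle : infeasibility (z + t *: d) <= infeasibility z + t *
      (\sum_i (2 * m i * DG i t + t * (DG i t * DG i t)) +
       \sum_j (2 * H j z * DH j t + t * (DH j t * DH j t))).
    rewrite /infeasibility mulrDr addrACA !mulr_sumr -!big_split /=.
    apply: lerD; apply: ler_sum => i _.
      rewrite (dq _ _ _ (erefl (DG i t))).
      apply: le_trans (min0_sqrD_le _ _) _; rewrite -/(m i) le_eqVlt.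
      by apply/orP; left; apply/eqP; ring.
    rewrite (dq _ _ _ (erefl (DH i t))) le_eqVlt.
    by apply/orP; left; apply/eqP; ring.
  have kle := ler_wpM2l (ler0n R k) infle.
  have ele := ler_wpM2l (ltW e0) nle.
  rewrite /q.
  set S := \sum_i _ + \sum_j _ in kle *.
  set N1 := `|z - z0 + _| in ele *.
  clearbody S N1 => zt.
  by nra.
have -> : multiplier_form (fun i => - (2 * k%:R * m i))
    (fun j => 2 * k%:R * H j z) z d =
  k%:R * (\sum_i 2 * m i * 'D_d (G i) z + \sum_j 2 * H j z * 'D_d (H j) z).
  rewrite /multiplier_form mulrDr !mulr_sumr addrC -sumrN.
  by congr (_ + _); apply: eq_bigr => i _; ring.
by lra.
Qed.

End Multipliers.

(** * Limiting normals and constraint qualification *)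

(** Limits along an ultrafilter replace the extraction of convergent
    subsequences of multipliers. *)
Lemma ultra_bounded_cvg (R : realType) T (U : set_system T) (f : T -> R) (r : R) :
  UltraFilter U -> (forall t, `|f t| <= r) -> exists l : R, f @ U --> l.
Proof.
move=> uU fr; have fU : (f @ U) `[- r, r]%classic.
  by apply: (@filterE _ U) => t; rewrite /= in_itv /= -ler_norml; exact: fr.
have [l [_ cl]] := @segment_compact R (- r) r _ _ fU.
exists l => B nB; have [//|UB] := in_ultra_setVsetC (f @^-1` B) uU.
by have [y [NBy By]] := cl (~` B) B UB nB.
Qed.

Section LimitingMultipliers.
Variables (R : realType) (n : nat) (I J : finType).
Variables (G : I -> 'cV[R]_n -> R) (H : J -> 'cV[R]_n -> R).

Lemma multiplier_formZ mu xi z d (c : R) :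
  multiplier_form G H (fun i => c * mu i) (fun j => c * xi j) z d =
  c * multiplier_form G H mu xi z d.
Proof.
by rewrite /multiplier_form mulrBr !mulr_sumr; congr (_ - _);
  apply: eq_bigr => i _; rewrite mulrA.
Qed.

Hypothesis G_continuous : forall i, continuous (G i).
Hypothesis H_continuous : forall j, continuous (H j).
Hypothesis G_derivable : forall i z d, derivable (G i) z d.
Hypothesis H_derivable : forall j z d, derivable (H j) z d.
Hypothesis DG_continuous : forall i d, continuous (fun z => 'D_d (G i) z : R).
Hypothesis DH_continuous : forall j d, continuous (fun z => 'D_d (H j) z : R).

(** The hypothesis is the constraint qualification that no nonzero multiplier is
    abnormal.  The approximate multipliers are divided by [s = 1 + |mu| + |xi|];
    the limit [(rho, m, x)] of [(1, mu, xi) / s] has total mass one.  If [rho]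
    vanished, [(m, x)] would be a nonzero abnormal multiplier; otherwise
    [(m, x) / rho] represents the limiting normal. *)
Lemma limiting_normal_multipliers z h :
  (forall mu xi, (forall i, 0 <= mu i) -> (forall i, mu i * G i z = 0) ->
     (forall d, 0 <= multiplier_form G H mu xi z d) ->
     (forall i, mu i = 0) /\ (forall j, xi j = 0)) ->
  limiting_normal_cone (feasible_set G H) z h ->
  exists mu xi, [/\ forall i, 0 <= mu i, forall i, mu i * G i z = 0
    & forall d, dot h d <= multiplier_form G H mu xi z d].
Proof.
move=> cq [xs [hs [fxs xs_cvg hs_normal hs_cvg]]].
pose e k : R := k.+1%:R^-1.
have e_gt0 k : 0 < e k by rewrite invr_gt0 ltr0n.
have /choice[zm zmP] : forall k, exists p : 'cV[R]_n * (I -> R) * (J -> R),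
    [/\ `|p.1.1 - xs k| < e k, forall i, 0 <= p.1.2 i,
      forall i, 0 < p.1.2 i -> G i p.1.1 < 0
    & forall d, dot (hs k) d <=
        multiplier_form G H p.1.2 p.2 p.1.1 d + e k * `|d|].
  move=> k; have [y [mu [xi P]]] := penalty_multipliers G_continuous
    H_continuous G_derivable H_derivable (fxs k) (hs_normal k) (e_gt0 k).
  by exists (y, mu, xi).
pose zs k := (zm k).1.1; pose mu k := (zm k).1.2; pose xi k := (zm k).2.
pose s k := 1 + \sum_i mu k i + \sum_j `|xi k j|.
have mu_ge0 k i : 0 <= mu k i by have [_ + _ _] := zmP k; exact.
have s_ge1 k : 1 <= s k.
  by rewrite /s -addrA lerDl addr_ge0 // sumr_ge0.
have s_gt0 k : 0 < s k by exact: lt_le_trans (s_ge1 k).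
have [U [uU ooU]] := ultraFilterLemma (eventually_filter).
have e_cvg : e @ U --> (0 : R).
  by apply: cvg_trans (@cvg_harmonic R); exact: cvg_app.
have {}xs_cvg : xs @ U --> z by apply: cvg_trans xs_cvg; exact: cvg_app.
have {}hs_cvg : hs @ U --> h by apply: cvg_trans hs_cvg; exact: cvg_app.
have zs_cvg : zs @ U --> z.
  have d_cvg : zs k - xs k @[k --> U] --> (0 : 'cV[R]_n).
    apply/cvgr0Pnorm_lt => r r0.
    have er := cvgr0_norm_lt _ e_cvg _ r0.
    apply: filterS (er _) => k.
    rewrite gtr0_norm //; apply: lt_trans.
    by have [] := zmP k.
  have -> : zs = (fun k => zs k - xs k) \+ xs.
    by apply/funext => k /=; rewrite subrK.
  by rewrite -[z]add0r; exact: cvgD.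
have inv_bounded k : `|(s k)^-1| <= 1.
  by rewrite gtr0_norm ?invr_gt0 // invf_le1.
have mu_bounded i k : `|(s k)^-1 * mu k i| <= 1.
  rewrite normrM gtr0_norm ?invr_gt0 // ler_pdivrMl // mulr1 ger0_norm //.
  rewrite /s (bigD1 i) //=.
  have : 0 <= \sum_(i0 | i0 != i) mu k i0 by exact: sumr_ge0.
  have : 0 <= \sum_j `|xi k j| by exact: sumr_ge0.
  by lra.
have xi_bounded j k : `|(s k)^-1 * xi k j| <= 1.
  rewrite normrM gtr0_norm ?invr_gt0 // ler_pdivrMl // mulr1.
  rewrite /s [X in _ + X](bigD1 j) //=.
  have : 0 <= \sum_(i0 | i0 != j) `|xi k i0| by exact: sumr_ge0.
  have : 0 <= \sum_i mu k i by exact: sumr_ge0.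
  by lra.
have [rho rho_cvg] := ultra_bounded_cvg uU inv_bounded.
have /choice[m m_cvg] i := ultra_bounded_cvg uU (mu_bounded i).
have /choice[x x_cvg] j := ultra_bounded_cvg uU (xi_bounded j).
have rho_ge0 : 0 <= rho.
  by apply: (cvgr_to_ge rho_cvg); apply: filterE => k; rewrite invr_ge0 ltW.
have m_ge0 i : 0 <= m i.
  apply: (cvgr_to_ge (m_cvg i)); apply: filterE => k.
  by rewrite mulr_ge0 // invr_ge0 ltW.
have normalised : rho + \sum_i m i + \sum_j `|x j| = 1.
  have one_cvg : (s k)^-1 + \sum_i (s k)^-1 * mu k i +
      \sum_j `|(s k)^-1 * xi k j| @[k --> U] -->
      rho + \sum_i m i + \sum_j `|x j|.
    apply: cvgD; first by apply: cvgD => //; exact: cvg_sumr.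
    by apply: cvg_sumr => j; exact: cvg_norm.
  apply: (cvg_unique _ one_cvg) => //.
  have -> : (fun k => (s k)^-1 + \sum_i (s k)^-1 * mu k i +
      \sum_j `|(s k)^-1 * xi k j|) = fun=> 1.
    apply/funext => k; under [X in _ + _ + X]eq_bigr do
      rewrite normrM gtr0_norm ?invr_gt0 //.
    by rewrite -!mulr_sumr -[X in X + _ + _]mulr1 -!mulrDr mulVf // gt_eqF.
  exact: cvg_cst.
have Gz_cvg i : G i (zs k) @[k --> U] --> G i z.
  exact: (cvg_comp zs (G i) zs_cvg (@G_continuous i z)).
have G_ge0 i : 0 <= G i z.
  apply: (cvgr_to_ge (cvg_comp xs (G i) xs_cvg (@G_continuous i z))).
  by apply: filterE => k; have [+ _] := fxs k; exact.
have compl i : m i * G i z = 0.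
  apply/eqP; rewrite eq_le mulr_ge0 // andbT.
  have p_cvg : ((s k)^-1 * mu k i) * G i (zs k) @[k --> U] --> m i * G i z.
    exact: cvgM.
  apply: (cvgr_to_le p_cvg); apply: filterE => k.
  rewrite -mulrA mulr_ge0_le0 //; first by rewrite invr_ge0 ltW.
  have [->|mui0] := eqVneq (mu k i) 0; first by rewrite mul0r.
  apply: mulr_ge0_le0 => //; apply: ltW.
  have [_ _ + _] := zmP k; apply.
  by rewrite lt_neqAle eq_sym mui0 mu_ge0.
have ineq d : rho * dot h d <= multiplier_form G H m x z d.
  have l_cvg : (s k)^-1 * dot (hs k) d - (s k)^-1 * (e k * `|d|)
      @[k --> U] --> rho * dot h d - rho * (0 * `|d|).
    apply: cvgB; apply: cvgM => //.
      by apply: cvg_dot => //; exact: cvg_cst.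
    by apply: cvgM => //; exact: cvg_cst.
  have r_cvg : multiplier_form G H (fun i => (s k)^-1 * mu k i)
      (fun j => (s k)^-1 * xi k j) (zs k) d @[k --> U] -->
      multiplier_form G H m x z d.
    apply: cvgB; apply: cvg_sumr => i; apply: cvgM => //.
      exact: (cvg_comp zs (fun y => 'D_d (H i) y) zs_cvg (@DH_continuous i d z)).
    exact: (cvg_comp zs (fun y => 'D_d (G i) y) zs_cvg (@DG_continuous i d z)).
  have -> : rho * dot h d = rho * dot h d - rho * (0 * `|d|).
    by rewrite mul0r mulr0 subr0.
  rewrite -subr_ge0; apply: (cvgr_to_ge (cvgB r_cvg l_cvg)).
  apply: filterE => k.
  have -> : forall f g : nat -> R, (f - g) k = f k - g k by [].
  rewrite multiplier_formZ -mulrBr -mulrBr.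
  apply: mulr_ge0; first by rewrite invr_ge0 ltW.
  have [_ _ _ /(_ d)] := zmP k; rewrite -/(zs k) -/(mu k) -/(xi k).
  by lra.
have rho_gt0 : 0 < rho.
  rewrite lt_neqAle rho_ge0 andbT eq_sym; apply/eqP => rho0.
  have [|m0 x0] := cq m x m_ge0 compl.
    by move=> d; have := ineq d; rewrite rho0 mul0r.
  move: normalised; rewrite rho0 !big1 ?addr0 => [/eqP|j _|i _].
  - by rewrite eq_sym oner_eq0.
  - by rewrite x0 normr0.
  - exact: m0.
exists (fun i => rho^-1 * m i), (fun j => rho^-1 * x j); split.
- by move=> i; rewrite mulr_ge0 ?invr_ge0.
- by move=> i; rewrite -mulrA compl mulr0.
- by move=> d; rewrite multiplier_formZ ler_pdivlMl.
Qed.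

End LimitingMultipliers.

(** * Slopes of regular subgradients *)

Section RegularSubgradients.
Variables (R : realType) (n : nat).
Implicit Types (f : 'cV[R]_n -> R) (x d g : 'cV[R]_n).

Lemma regular_subgradient_slope f x d g (s : R) :
  regular_subdifferential f x g ->
  t^-1 * (f (x + t *: d) - f x) @[t --> 0^'+] --> s -> dot g d <= s.
Proof.
move=> gf slope_cvg; apply/ler_addgt0Pr => e e0.
pose c := e / (enorm d + 1).
have d1 : 0 < enorm d + 1 by rewrite ltr_wpDl ?enorm_ge0.
have c0 : 0 < c by rewrite divr_gt0.
have line_cvg : x + t *: d @[t --> 0^'+] --> x.
  apply: cvg_at_right_filter; rewrite -[X in _ --> X]addr0 -(scale0r d).
  apply: cvgD; first exact: cvg_cst.
  by apply: cvgZ; [exact: cvg_id|exact: cvg_cst].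
have fline : \forall t \near 0^'+, f x + dot g (x + t *: d - x) -
    c * enorm (x + t *: d - x) <= f (x + t *: d) by exact: line_cvg _ (gf c c0).
have le_s : dot g d - c * enorm d <= s.
  apply: (cvgr_to_ge slope_cvg).
  move: (nbhs_right_gt (0 : R)) fline; apply: filterS2 => t t0.
  rewrite [X in dot g X]addrAC [X in enorm X]addrAC subrr add0r dotZ enormZ.
  rewrite gtr0_norm // => ft.
  by rewrite ler_pdivlMl //; nra.
have : c * enorm d <= e.
  rewrite /c mulrAC ler_pdivrMr // ler_pM2l //.
  by rewrite lerDl.
by lra.
Qed.

Lemma affine_cvg (s q : R) : s + t * q @[t --> (0 : R)] --> s.
Proof.
rewrite -[X in _ --> X]addr0 -[X in _ --> _ + X](mul0r q).
apply: cvgD; first exact: cvg_cst.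
by apply: cvgM; [exact: cvg_id|exact: cvg_cst].
Qed.

(** Only agreement with a quadratic near [t = 0] is required, which covers the
    piecewise linear activation away from its kink. *)
Lemma quadratic_slope f x d (s q : R) :
  (\forall t \near 0, f (x + t *: d) = f x + t * s + t ^+ 2 * q) ->
  t^-1 * (f (x + t *: d) - f x) @[t --> 0^'+] --> s.
Proof.
move=> fq.
have l_cvg : s + t * q @[t --> 0^'+] --> s.
  by apply: cvg_at_right_filter; exact: affine_cvg.
apply: cvg_trans l_cvg; apply: near_eq_cvg.
have t0 := nbhs_right_gt (0 : R).
have {}fq : \forall t \near 0^'+, f (x + t *: d) = f x + t * s + t ^+ 2 * q.
  by apply: filterS fq => t.
move: t0 fq; apply: filterS2 => t t0 ->.
by field; rewrite gt_eqF.
Qed.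

(** Both [d] and [- d] have a one-sided slope, and each bounds the subgradient
    on one side. *)
Lemma regular_subgradient_quadratic f x d g (s q : R) :
  regular_subdifferential f x g ->
  (\forall t \near 0, f (x + t *: d) = f x + t * s + t ^+ 2 * q) ->
  dot g d = s.
Proof.
move=> gf fq; apply/eqP; rewrite eq_le.
rewrite (regular_subgradient_slope gf (quadratic_slope fq)) /=.
rewrite -lerN2 -dotN; apply: (regular_subgradient_slope gf).
apply: (quadratic_slope (q := q)).
have : - t @[t --> (0 : R)] --> (0 : R).
  by rewrite -[X in _ --> X]oppr0; apply: cvgN; exact: cvg_id.
move=> /(_ _ fq) fqN; near=> t.
have -> : t *: - d = (- t) *: d by rewrite scalerN scaleNr.
have -> : f (x + (- t) *: d) = f x + (- t) * s + (- t) ^+ 2 * q by near: t.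
by ring.
Unshelve. all: by end_near. Qed.

Lemma is_derive_quadratic f x d (s q : R) :
  (forall t, f (x + t *: d) = f x + t * s + t ^+ 2 * q) ->
  is_derive x d f s.
Proof.
move=> fq.
have quot_cvg : t^-1 *: ((f \o shift x) (t *: d) - f x) @[t --> 0^'] --> s.
  have l_cvg : s + t * q @[t --> (0 : R)^'] --> s.
    by apply: cvg_within_filter; exact: affine_cvg.
  apply: cvg_trans l_cvg; apply: near_eq_cvg.
  near=> t; rewrite /= [t *: d + x]addrC fq /GRing.scale /=.
  by field; near: t; exact: nbhs_dnbhs_neq.
by split; [apply/cvg_ex; exists s|exact: cvg_lim quot_cvg].
Unshelve. all: by end_near. Qed.

End RegularSubgradients.

(** * Layers, preactivations and forward recursion *)

Section NetworkCoordinates.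
Variables (R : realType) (L N : nat) (d : nat -> nat).
Implicit Types (v u : 'cV[R]_(vdim L N d)) (w : 'cV[R]_(wdim L d)).

(** The position in a stacked vector of the entry of neuron [k] of layer
    [l.+1] for the sample [n]. *)
Definition neuron (l : 'I_L) (k : 'I_(d l.+1)) (n : 'I_N) : 'I_(vdim L N d) :=
  @tagnat.Rank L (fun l : 'I_L => N * d l.+1)%N l (mxtens_index (n, k)).

Lemma blockE v l k n : block v l k n = v (neuron k n) 0.
Proof. by rewrite !mxE. Qed.

Lemma neuronP (P : 'I_(vdim L N d) -> Prop) :
  (forall l k n, P (@neuron l k n)) -> forall i, P i.
Proof.
move=> Pn i; rewrite -(tagnat.sig2K i) -[tagnat.sig2 i]mxtens_unindexK.
by case: (mxtens_unindex _) => n k; exact: Pn.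
Qed.

Lemma neuron_inj (l l' : 'I_L) (k : 'I_(d l.+1)) n (k' : 'I_(d l'.+1)) n' :
  neuron k n = neuron k' n' -> l = l'.
Proof.
by move=> /(congr1 tagnat.sig1); rewrite /neuron !tagnat.Rank1K.
Qed.

Lemma sum_neuron (F : 'I_(vdim L N d) -> R) :
  \sum_i F i = \sum_l \sum_n \sum_k F (@neuron l k n).
Proof.
rewrite (reindex (@tagnat.rank L (fun l => N * d l.+1)%N)) /=; last first.
  exact: tagnat.rank_bij_on.
rewrite (eq_bigr (fun p => F (tagnat.Rank (tag p) (tagged p)))); last first.
  by move=> p _; rewrite tagnat.rankE.
rewrite -(sig_big_dep xpredT (fun _ => xpredT) (fun l p => F (tagnat.Rank l p))) /=.
apply: eq_bigr => l _.
rewrite (reindex (@mxtens_index _ _)) /=; last first.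
  by exists (@mxtens_unindex _ _) => ? _;
    rewrite ?mxtens_indexK ?mxtens_unindexK.
by rewrite pair_bigA; apply: eq_bigr => -[n k].
Qed.

Lemma beta_vecE (beta : 'I_L -> R) (l : 'I_L) (k : 'I_(d l.+1)) n :
  beta_vec N d beta (neuron k n) 0 = beta l.
Proof. by rewrite !mxE /neuron tagnat.Rank1K. Qed.

Lemma preactE (X : 'M[R]_(d 0%N, N)) v w (l : 'I_L) (k : 'I_(d l.+1)) n :
  (Psi X v *m w) (neuron k n) 0 =
  \sum_j weight w l k j * layer X v (ltnW (ltn_ord l)) j n.
Proof.
have colE p q (M : 'M[R]_(p, q)) i j : col j M i 0 = M i j by rewrite mxE.
have bias0 : bias 0 l k 0 = 0 :> R by rewrite !mxE.
have /(congr1 (fun A : 'cV[R]_(d l.+1) => A k 0)) := preactivationE X v w 0 l n.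
rewrite mulmx0 addr0 colE => Hb.
rewrite -[LHS]blockE [LHS]Hb.
by rewrite mxE bias0 addr0 mxE; apply: eq_bigr => j _; rewrite colE.
Qed.

Lemma layer_affine (X : 'M[R]_(d 0%N, N)) v v' (t : R) l (lL : (l <= L)%N) j n :
  layer X (v + t *: v') lL j n = layer X v lL j n + t * layer 0 v' lL j n.
Proof.
case: l lL j => [|l] lL j /=; first by rewrite mxE mulr0 addr0.
by rewrite !mxE.
Qed.

(** [Psi] is affine in [v], and its linear part is [Psi] with zero data: the
    layer [V_0 = X] is the only constant one. *)
Lemma Psi_affine (X : 'M[R]_(d 0%N, N)) v v' (t : R) w :
  Psi X (v + t *: v') *m w = Psi X v *m w + t *: (Psi 0 v' *m w).
Proof.
have addE (x y : 'cV[R]_(vdim L N d)) i : (x + t *: y) i 0 = x i 0 + t * y i 0.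
  by rewrite !mxE.
apply/colP; apply: neuronP => l k n; rewrite addE.
apply: (etrans (preactE X (v + t *: v') w k n)).
apply: etrans (esym (congr2 (fun a b => a + t * b) (preactE X v w k n)
  (preactE 0 v' w k n))).
rewrite mulr_sumr -big_split; apply: eq_bigr => j _ /=.
by rewrite layer_affine; ring.
Qed.

Lemma Psi_mul_line (X : 'M[R]_(d 0%N, N)) v v' (t : R) w w' i :
  (Psi X (v + t *: v') *m (w + t *: w')) i 0 =
  (Psi X v *m w) i 0 + t * ((Psi X v *m w') i 0 + (Psi 0 v' *m w) i 0) +
  t ^+ 2 * (Psi 0 v' *m w') i 0.
Proof.
have e1 := mulmxDr (Psi X (v + t *: v')) w (t *: w').
have e2 := esym (scalemxAr t (Psi X (v + t *: v')) w').
have entryE (x a b c y p q : 'cV[R]_(vdim L N d)) : p = y + q ->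
    y = x + t *: a -> q = t *: (b + t *: c) ->
    p i 0 = x i 0 + t * (b i 0 + a i 0) + t ^+ 2 * c i 0.
  by move=> -> -> ->; rewrite !mxE; ring.
apply: (entryE _ _ _ _ _ _ _ e1 (Psi_affine X v v' t w)).
exact: (etrans e2 (congr1 (fun M => t *: M) (Psi_affine X v v' t w'))).
Qed.

Lemma layer_cvg T (F : set_system T) {FF : Filter F} (X : 'M[R]_(d 0%N, N))
    (f : T -> 'cV[R]_(vdim L N d)) v l (lL : (l <= L)%N) j n :
  f @ F --> v -> layer X (f t) lL j n @[t --> F] --> layer X v lL j n.
Proof.
case: l lL j => [|l] lL j fv /=; first exact: cvg_cst.
rewrite !mxE; under eq_fun do rewrite !mxE.
exact: cvg_coord.
Qed.

Lemma weight_cvg T (F : set_system T) {FF : Filter F}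
    (f : T -> 'cV[R]_(wdim L d)) w l k j :
  f @ F --> w -> weight (f t) l k j @[t --> F] --> weight w l k j.
Proof.
move=> fw; rewrite !mxE; under eq_fun do rewrite !mxE.
exact: cvg_coord.
Qed.

Lemma Psi_mul_cvg T (F : set_system T) {FF : Filter F} (X : 'M[R]_(d 0%N, N))
    (f : T -> 'cV[R]_(vdim L N d)) (g : T -> 'cV[R]_(wdim L d)) v w i :
  f @ F --> v -> g @ F --> w ->
  (Psi X (f t) *m g t) i 0 @[t --> F] --> (Psi X v *m w) i 0.
Proof.
move=> fv gw; move: i; apply: neuronP => l k n.
rewrite preactE; under eq_fun do rewrite preactE.
by apply: cvg_sumr => j; apply: cvgM; [exact: weight_cvg|exact: layer_cvg].
Qed.

(** A fixed point [v] of this map is a direction such that, with [u] the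
    preactivation increment that it induces, every slack grows at least at the
    rate [s]: indeed [v - u] and [v - alpha u] are both at least [s]. *)
Definition response w (s v : 'cV[R]_(vdim L N d)) : 'cV[R]_(vdim L N d) :=
  \col_i (`|(Psi 0 v *m w) i 0| + s i 0).

Lemma responseE w s v i :
  response w s v i 0 = `|(Psi 0 v *m w) i 0| + s i 0.
Proof. by rewrite mxE. Qed.

(** The preactivation of a layer reads only the preceding layer of [v]. *)
Lemma response_local w s v v' (m : nat) :
  (forall l : 'I_L, (l < m)%N -> block v l = block v' l) ->
  forall l : 'I_L, (l < m.+1)%N ->
    block (response w s v) l = block (response w s v') l.
Proof.
move=> vv' l lm; apply/matrixP => k n.
suff e : (Psi 0 v *m w) (neuron k n) 0 = (Psi 0 v' *m w) (neuron k n) 0.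
  apply: (etrans (blockE _ k n)); apply: etrans (esym (blockE _ k n)).
  apply: (etrans (responseE _ _ _ _)); apply: etrans (esym (responseE _ _ _ _)).
  exact: (congr1 (fun a => `|a| + s (neuron k n) 0) e).
apply: (etrans (preactE 0 v w k n)); apply: etrans (esym (preactE 0 v' w k n)).
apply: eq_bigr => j _; congr (_ * _).
move: (ltnW _) j; case El : (nat_of_ord l) => [|l'] lL j //=.
by rewrite vv' // -ltnS -El.
Qed.

(** By locality, [L] iterations from any starting point reach the fixed point. *)
Lemma exists_response_fixpoint w s : exists v, response w s v = v.
Proof.
have [v vS] : exists v : nat -> 'cV[R]_(vdim L N d),
    forall m, v m.+1 = response w s (v m).
  by exists (fun m => iter m (response w s) 0).
have stable m : forall l : 'I_L, (l < m)%N -> block (v m.+1) l = block (v m) l.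
  elim: m => [//|m IH] l lm.
  by have := response_local w s IH lm; rewrite -!vS.
exists (v L); rewrite -vS; apply/colP; apply: neuronP => l k n.
have /matrixP/(_ k n) := stable L l (ltn_ord l).
by rewrite (blockE (v L.+1)) (blockE (v L)).
Qed.

End NetworkCoordinates.

(** * Normals to the lifted feasible set *)

Section LiftedPolyhedralSet.
Variables (R : realType) (L N : nat) (d : nat -> nat).
Variables (X : 'M[R]_(d 0%N, N)) (alpha : R).
Hypotheses (alpha_gt0 : 0 < alpha) (alpha_lt1 : alpha < 1).
Local Notation m := (vdim L N d).
Local Notation zspace := 'cV[R]_(zdim L N d).
Implicit Types (z dz h : zspace) (t : R).

Definition zvec (w : 'cV[R]_(wdim L d)) (b : 'cV[R]_(bdim L d))
    (v u : 'cV[R]_m) : zspace := col_mx w (col_mx b (col_mx v u)).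

Lemma wpart_zvec w b v u : wpart (zvec w b v u) = w.
Proof. exact: col_mxKu. Qed.

Lemma bpart_zvec w b v u : bpart (zvec w b v u) = b.
Proof. by rewrite /bpart col_mxKd col_mxKu. Qed.

Lemma vpart_zvec w b v u : vpart (zvec w b v u) = v.
Proof. by rewrite /vpart !col_mxKd col_mxKu. Qed.

Lemma upart_zvec w b v u : upart (zvec w b v u) = u.
Proof. by rewrite /upart !col_mxKd. Qed.

Definition zpartE := (wpart_zvec, bpart_zvec, vpart_zvec, upart_zvec).

Lemma zvecK z : zvec (wpart z) (bpart z) (vpart z) (upart z) = z.
Proof. by rewrite /zvec !vsubmxK. Qed.

Lemma wpartD z dz t : wpart (z + t *: dz) = wpart z + t *: wpart dz.
Proof. by apply/colP => i; rewrite !mxE. Qed.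

Lemma bpartD z dz t : bpart (z + t *: dz) = bpart z + t *: bpart dz.
Proof. by apply/colP => i; rewrite !mxE. Qed.

Lemma vpartD z dz t : vpart (z + t *: dz) = vpart z + t *: vpart dz.
Proof. by apply/colP => i; rewrite !mxE. Qed.

Lemma upartD z dz t : upart (z + t *: dz) = upart z + t *: upart dz.
Proof. by apply/colP => i; rewrite !mxE. Qed.

Definition zpartD := (wpartD, bpartD, vpartD, upartD).

Lemma dot_col_mx p q (h : 'cV[R]_(p + q)) (x : 'cV[R]_p) (y : 'cV[R]_q) :
  dot h (col_mx x y) = dot (usubmx h) x + dot (dsubmx h) y.
Proof.
rewrite /dot big_split_ord; congr (_ + _); apply: eq_bigr => i _.
  by rewrite col_mxEu mxE.
by rewrite col_mxEd mxE.
Qed.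

Lemma dot_zvec h w b v u : dot h (zvec w b v u) =
  dot (wpart h) w + dot (bpart h) b + dot (vpart h) v + dot (upart h) u.
Proof. by rewrite /zvec !dot_col_mx !addrA. Qed.

Lemma wpart_cvg T (F : set_system T) {FF : Filter F} (f : T -> zspace) z :
  f @ F --> z -> wpart (f x) @[x --> F] --> wpart z.
Proof.
move=> fz; apply: cvg_mx => i j; rewrite mxE; under eq_fun do rewrite mxE.
exact: cvg_coord.
Qed.

Lemma bpart_cvg T (F : set_system T) {FF : Filter F} (f : T -> zspace) z :
  f @ F --> z -> bpart (f x) @[x --> F] --> bpart z.
Proof.
move=> fz; apply: cvg_mx => i j; rewrite !mxE; under eq_fun do rewrite !mxE.
exact: cvg_coord.
Qed.

Lemma vpart_cvg T (F : set_system T) {FF : Filter F} (f : T -> zspace) z :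
  f @ F --> z -> vpart (f x) @[x --> F] --> vpart z.
Proof.
move=> fz; apply: cvg_mx => i j; rewrite !mxE; under eq_fun do rewrite !mxE.
exact: cvg_coord.
Qed.

Lemma upart_cvg T (F : set_system T) {FF : Filter F} (f : T -> zspace) z :
  f @ F --> z -> upart (f x) @[x --> F] --> upart z.
Proof.
move=> fz; apply: cvg_mx => i j; rewrite !mxE; under eq_fun do rewrite !mxE.
exact: cvg_coord.
Qed.

Definition slack (i : 'I_m + 'I_m) (z : zspace) : R :=
  match i with
  | inl i => vpart z i 0 - upart z i 0
  | inr i => vpart z i 0 - alpha * upart z i 0
  end.

Definition residual (j : 'I_m) (z : zspace) : R :=
  upart z j 0 - ((Psi X (vpart z) *m wpart z) j 0 + (Amx *m bpart z) j 0).

(** The derivative of [residual j] at [z] in the direction [dz]. *)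
Definition residual_slope (j : 'I_m) (z dz : zspace) : R :=
  upart dz j 0 - ((Psi X (vpart z) *m wpart dz) j 0 +
    (Psi 0 (vpart dz) *m wpart z) j 0 + (Amx *m bpart dz) j 0).

Lemma Omega2_feasible_set : Omega2 X alpha = feasible_set slack residual.
Proof.
have cE p (x y : 'cV[R]_p) i : (x - y) i 0 = x i 0 - y i 0 by rewrite !mxE.
have sE p (x : 'cV[R]_p) c i : (c *: x) i 0 = c * x i 0 by rewrite !mxE.
apply/seteqP; split => z /=.
  move=> [G1 G2 He]; split=> [[i|i] /=|j].
  - by rewrite -cE.
  - by rewrite -sE -cE.
  - rewrite /residual {1}He; apply/eqP; rewrite subr_eq0; apply/eqP.
    by rewrite [LHS]mxE.
move=> [G0 He]; split=> [i|i|].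
- by rewrite cE; exact: (G0 (inl i)).
- by rewrite cE sE; exact: (G0 (inr i)).
- apply/colP => j; have /eqP := He j; rewrite subr_eq0 => /eqP ->.
  by rewrite [RHS]mxE.
Qed.

Lemma slack_line i z dz t : slack i (z + t *: dz) = slack i z + t * slack i dz.
Proof.
have addE (x y : 'cV[R]_m) k : (x + t *: y) k 0 = x k 0 + t * y k 0.
  by rewrite !mxE.
by case: i => i; rewrite /slack zpartD upartD !addE; ring.
Qed.

Lemma residual_line j z dz t : residual j (z + t *: dz) =
  residual j z + t * residual_slope j z dz +
  t ^+ 2 * - (Psi 0 (vpart dz) *m wpart dz) j 0.
Proof.
have addE (x y : 'cV[R]_m) : (x + t *: y) j 0 = x j 0 + t * y j 0.
  by rewrite !mxE.
have bE : (Amx *m bpart (z + t *: dz)) j 0 =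
    (Amx *m bpart z) j 0 + t * (Amx *m bpart dz) j 0.
  by rewrite bpartD mulmxDr -scalemxAr addE.
have wE := Psi_mul_line X (vpart z) (vpart dz) t (wpart z) (wpart dz) j.
have collect (u0 u1 p0 p1 p2 p3 b0 b1 : R) :
    u0 + t * u1 - (p0 + t * (p1 + p2) + t ^+ 2 * p3 + (b0 + t * b1)) =
    u0 - (p0 + b0) + t * (u1 - (p1 + p2 + b1)) + t ^+ 2 * - p3 by ring.
rewrite /residual /residual_slope bE upartD addE vpartD wpartD wE.
exact: collect.
Qed.

Lemma slack_is_derive i z dz : is_derive z dz (slack i) (slack i dz).
Proof.
apply: (is_derive_quadratic (q := 0)) => t.
by rewrite slack_line mulr0 addr0.
Qed.

Lemma residual_is_derive j z dz :
  is_derive z dz (residual j) (residual_slope j z dz).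
Proof. exact: is_derive_quadratic (residual_line j z dz). Qed.

Lemma slack_continuous i : continuous (slack i).
Proof.
move=> z; have id_z : (fun y : zspace => y) @ z --> z by exact: cvg_id.
have v_cvg k : vpart y k 0 @[y --> z] --> vpart z k 0.
  exact: cvg_coord (vpart_cvg id_z).
have u_cvg k : upart y k 0 @[y --> z] --> upart z k 0.
  exact: cvg_coord (upart_cvg id_z).
case: i => i; rewrite /slack /=.
  exact: (cvgB (v_cvg i) (u_cvg i)).
exact: (cvgB (v_cvg i) (cvgM (cvg_cst alpha) (u_cvg i))).
Qed.

Lemma Amx_mul_cvg T (F : set_system T) {FF : Filter F}
    (f : T -> 'cV[R]_(bdim L d)) b (j : 'I_m) : f @ F --> b ->
  (Amx *m f x) j 0 @[x --> F] --> ((Amx : 'M[R]_(m, bdim L d)) *m b) j 0.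
Proof.
move=> fb; rewrite mxE; under eq_fun do rewrite mxE.
by apply: cvg_sumr => k; apply: cvgM; [exact: cvg_cst|exact: cvg_coord].
Qed.

Lemma residual_continuous j : continuous (residual j).
Proof.
move=> z; have id_z : (fun y : zspace => y) @ z --> z by exact: cvg_id.
have u_cvg : upart y j 0 @[y --> z] --> upart z j 0.
  exact: cvg_coord (upart_cvg id_z).
have p_cvg : (Psi X (vpart y) *m wpart y) j 0 @[y --> z] -->
    (Psi X (vpart z) *m wpart z) j 0.
  exact: Psi_mul_cvg (vpart_cvg id_z) (wpart_cvg id_z).
have b_cvg : (Amx *m bpart y) j 0 @[y --> z] --> (Amx *m bpart z) j 0.
  exact: Amx_mul_cvg (bpart_cvg id_z).
exact: (cvgB u_cvg (cvgD p_cvg b_cvg)).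
Qed.

Lemma residual_slope_continuous j dz : continuous (residual_slope j ^~ dz).
Proof.
move=> z; have id_z : (fun y : zspace => y) @ z --> z by exact: cvg_id.
have p_cvg : (Psi X (vpart y) *m wpart dz) j 0 @[y --> z] -->
    (Psi X (vpart z) *m wpart dz) j 0.
  exact: Psi_mul_cvg (vpart_cvg id_z) (cvg_cst _).
have q_cvg : (Psi 0 (vpart dz) *m wpart y) j 0 @[y --> z] -->
    (Psi 0 (vpart dz) *m wpart z) j 0.
  exact: Psi_mul_cvg (cvg_cst _) (wpart_cvg id_z).
have c_cvg (c : R) : (fun _ : zspace => c) @ z --> c.
  exact: (@cst_continuous _ R c z).
exact: (cvgB (c_cvg _) (cvgD (cvgD p_cvg q_cvg) (c_cvg _))).
Qed.

(** [multiplier_form] for the lifted set, with the multipliers of the two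
    families of inequalities separated. *)
Definition lagrangian_slope (mu1 mu2 xi : 'cV[R]_m) z dz : R :=
  \sum_j xi j 0 * residual_slope j z dz -
  (\sum_i mu1 i 0 * slack (inl i) dz + \sum_i mu2 i 0 * slack (inr i) dz).

Lemma multiplier_formE mu xi z dz : multiplier_form slack residual mu xi z dz =
  lagrangian_slope (\col_i mu (inl i)) (\col_i mu (inr i)) (\col_j xi j) z dz.
Proof.
rewrite /multiplier_form /lagrangian_slope big_sumType /=.
congr (_ - (_ + _)); apply: eq_bigr => i _; rewrite mxE; congr (_ * _).
- by have [_ ->] := residual_is_derive i z dz.
- by have [_ ->] := slack_is_derive (inl i) z dz.
- by have [_ ->] := slack_is_derive (inr i) z dz.
Qed.

Lemma residual_slope_zvec0 j z v u :
  residual_slope j z (zvec 0 0 v u) = u j 0 - (Psi 0 v *m wpart z) j 0.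
Proof.
have mul0E p (M : 'M[R]_(m, p)) : (M *m (0 : 'cV[R]_p)) j 0 = 0.
  by rewrite mulmx0 mxE.
by rewrite /residual_slope wpart_zvec bpart_zvec !mul0E add0r addr0 vpart_zvec
  upart_zvec.
Qed.

Lemma slope_dominates (x s : R) :
  s <= `|x| + s - x /\ s <= `|x| + s - alpha * x.
Proof.
have x_le := ler_norm x.
have ax_le : alpha * x <= `|x|.
  rewrite (le_trans (ler_norm _)) // normrM gtr0_norm // ler_piMl //.
  exact: ltW.
by split; lra.
Qed.

(** Along the response to [s = 1] all slacks increase strictly while the
    residuals stay constant, which forces [mu1 = mu2 = 0].  The residual is the
    identity in [u], so that the direction [u = - xi] then gives [xi = 0]. *)
Lemma no_nonzero_abnormal_multiplier z (mu1 mu2 xi : 'cV[R]_m) :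
  (forall i, 0 <= mu1 i 0) -> (forall i, 0 <= mu2 i 0) ->
  (forall dz, 0 <= lagrangian_slope mu1 mu2 xi z dz) ->
  [/\ mu1 = 0, mu2 = 0 & xi = 0].
Proof.
move=> mu1_ge0 mu2_ge0 lag.
have [v vP] := exists_response_fixpoint (wpart z) (const_mx 1 : 'cV[R]_m).
pose u := Psi 0 v *m wpart z.
have vE i : v i 0 = `|u i 0| + 1.
  by rewrite -[in LHS]vP responseE [const_mx 1 i 0]mxE.
have [s1 s2] : (forall i, 1 <= slack (inl i) (zvec 0 0 v u)) /\
    (forall i, 1 <= slack (inr i) (zvec 0 0 v u)).
  by split=> i; rewrite /slack !zpartE vE; have [] := slope_dominates (u i 0) 1.
have p1 i : 0 <= mu1 i 0 * slack (inl i) (zvec 0 0 v u).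
  by rewrite mulr_ge0 // (le_trans ler01).
have p2 i : 0 <= mu2 i 0 * slack (inr i) (zvec 0 0 v u).
  by rewrite mulr_ge0 // (le_trans ler01).
have S0 : \sum_i mu1 i 0 * slack (inl i) (zvec 0 0 v u) +
    \sum_i mu2 i 0 * slack (inr i) (zvec 0 0 v u) = 0.
  apply/eqP; rewrite eq_le addr_ge0 ?sumr_ge0 // andbT.
  have := lag (zvec 0 0 v u); rewrite /lagrangian_slope big1 ?sub0r ?oppr_ge0 //.
  by move=> j _; rewrite residual_slope_zvec0 subrr mulr0.
move/eqP: S0; rewrite paddr_eq0 ?sumr_ge0 // => /andP[].
rewrite !psumr_eq0 // => /allP m1 /allP m2.
have mu10 : mu1 = 0.
  apply/colP => i; have /implyP/(_ isT) := m1 i (mem_index_enum _).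
  rewrite mulf_eq0 [_ == 0 in X in _ || X]gt_eqF ?(lt_le_trans ltr01) //.
  by rewrite orbF mxE => /eqP.
have mu20 : mu2 = 0.
  apply/colP => i; have /implyP/(_ isT) := m2 i (mem_index_enum _).
  rewrite mulf_eq0 [_ == 0 in X in _ || X]gt_eqF ?(lt_le_trans ltr01) //.
  by rewrite orbF mxE => /eqP.
split => //.
have := lag (zvec 0 0 0 (- xi)); rewrite /lagrangian_slope mu10 mu20.
rewrite [X in _ - (X + _)]big1 ?[X in _ - (_ + X)]big1;
  try by move=> i _; rewrite mxE mul0r.
rewrite addr0 subr0.
under eq_bigr => j _.
  rewrite residual_slope_zvec0.
  have -> : (Psi 0 0 *m wpart z) j 0 = 0.
    move: j; apply: neuronP => l k n; rewrite preactE big1 // => j _.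
    have := layer_affine (0 : 'M[R]_(d 0%N, N)) 0 (0 : 'cV[R]_m) (-1)
      (ltnW (ltn_ord l)) j n.
    by rewrite scaler0 addr0 mulN1r subrr => ->; rewrite mulr0.
  rewrite subr0 mxE mulrN -expr2.
  over.
rewrite sumrN oppr_ge0 => S0.
have : \sum_j xi j 0 ^+ 2 == 0.
  by rewrite eq_le S0 sumr_ge0 // => j _; exact: sqr_ge0.
rewrite psumr_eq0 => [/allP x0|j _]; last exact: sqr_ge0.
apply/colP => j; have /implyP/(_ isT) := x0 j (mem_index_enum _).
by rewrite sqrf_eq0 mxE => /eqP.
Qed.

Lemma Omega2_limiting_normal z h : limiting_normal_cone (Omega2 X alpha) z h ->
  exists mu1 mu2 xi : 'cV[R]_m,
  [/\ forall i, 0 <= mu1 i 0 /\ 0 <= mu2 i 0,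
      forall i, mu1 i 0 * slack (inl i) z = 0,
      forall i, mu2 i 0 * slack (inr i) z = 0
    & forall dz, dot h dz <= lagrangian_slope mu1 mu2 xi z dz].
Proof.
rewrite Omega2_feasible_set => nh.
have [|||||||mu [xi [mu0 compl ineq]]] :=
    @limiting_normal_multipliers R _ _ _ slack residual _ _ _ _ _ _ z h _ nh.
- exact: slack_continuous.
- exact: residual_continuous.
- by move=> i y dz; have [] := slack_is_derive i y dz.
- by move=> i y dz; have [] := residual_is_derive i y dz.
- move=> i dz; have -> : (fun y => 'D_dz (slack i) y) = fun=> slack i dz.
    by apply/funext => y; have [_ ->] := slack_is_derive i y dz.
  exact: (@cst_continuous _ R).
- move=> i dz; have -> : (fun y => 'D_dz (residual i) y) = residual_slope i ^~ dz.
    by apply/funext => y; have [_ ->] := residual_is_derive i y dz.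
  exact: residual_slope_continuous.
- move=> mu xi mu0 _ form0.
  have [||dz|m1 m2 x0] := @no_nonzero_abnormal_multiplier z
    (\col_i mu (inl i)) (\col_i mu (inr i)) (\col_j xi j).
  + by move=> i; rewrite mxE.
  + by move=> i; rewrite mxE.
  + by rewrite -multiplier_formE.
  split=> [[i|i]|j].
  + by have /colP/(_ i) := m1; rewrite !mxE.
  + by have /colP/(_ i) := m2; rewrite !mxE.
  + by have /colP/(_ j) := x0; rewrite !mxE.
exists (\col_i mu (inl i)), (\col_i mu (inr i)), (\col_j xi j); split.
- by move=> i; rewrite !mxE.
- by move=> i; rewrite mxE.
- by move=> i; rewrite mxE.
- by move=> dz; rewrite -multiplier_formE.
Qed.

End LiftedPolyhedralSet.

(** * Subgradients of the penalized objective *)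

Section Objective.
Variables (R : realType) (L N : nat) (d : nat -> nat).
Variables (X : 'M[R]_(d 0%N, N)) (Y : 'M[R]_(d L, N)).
Variables (alpha lambda_w lambda_v : R) (beta : 'I_L -> R).
Hypotheses (alpha_lt1 : alpha < 1) (alpha_gt0 : 0 < alpha).
Hypothesis beta_gt0 : forall l, 0 < beta l.
Local Notation m := (vdim L N d).
Local Notation zspace := 'cV[R]_(zdim L N d).
Local Notation Obar := (Obar X Y lambda_w lambda_v).
Local Notation Opp := (Opp X Y alpha lambda_w lambda_v beta).
Local Notation leaky t := (Num.max t (alpha * t)).
Implicit Types (z x g : zspace) (v u dv : 'cV[R]_m).

Lemma sqr_enorm p q (A : 'M[R]_(p, q)) :
  enorm A ^+ 2 = \sum_i \sum_j A i j ^+ 2.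
Proof.
by rewrite sqr_sqrtr // sumr_ge0 // => i _; rewrite sumr_ge0 // => j _;
  exact: sqr_ge0.
Qed.

Lemma ObarE w v : Obar w v =
  N%:R^-1 * (\sum_n \sum_k (layer X v (leqnn L) k n - Y k n) ^+ 2) +
  R1 lambda_w w + lambda_v * \sum_i v i 0 ^+ 2.
Proof.
rewrite /Defs.Obar /R2 sqr_enorm; congr (_ * _ + _ + _ * _).
  apply: eq_bigr => n _; rewrite sqr_enorm; apply: eq_bigr => k _.
  by rewrite big_ord1 !mxE.
by apply: eq_bigr => i _; rewrite big_ord1.
Qed.

Definition Obar_slope v dv : R :=
  N%:R^-1 * (\sum_n \sum_k
    2 * (layer X v (leqnn L) k n - Y k n) * layer 0 dv (leqnn L) k n) +
  lambda_v * \sum_i 2 * v i 0 * dv i 0.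

Definition Obar_curvature dv : R :=
  N%:R^-1 * (\sum_n \sum_k layer 0 dv (leqnn L) k n ^+ 2) +
  lambda_v * \sum_i dv i 0 ^+ 2.

Lemma Obar_line w v dv t : Obar w (v + t *: dv) =
  Obar w v + t * Obar_slope v dv + t ^+ 2 * Obar_curvature dv.
Proof.
have sqr_line (I : finType) (a b : I -> R) :
    \sum_i (a i + t * b i) ^+ 2 =
    \sum_i a i ^+ 2 + t * \sum_i 2 * a i * b i + t ^+ 2 * \sum_i b i ^+ 2.
  rewrite !mulr_sumr -!big_split /=; apply: eq_bigr => i _; ring.
have lossE : \sum_n \sum_k (layer X (v + t *: dv) (leqnn L) k n - Y k n) ^+ 2 =
    \sum_n \sum_k (layer X v (leqnn L) k n - Y k n) ^+ 2 +
    t * (\sum_n \sum_k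
      2 * (layer X v (leqnn L) k n - Y k n) * layer 0 dv (leqnn L) k n) +
    t ^+ 2 * \sum_n \sum_k layer 0 dv (leqnn L) k n ^+ 2.
  rewrite 2!mulr_sumr -!big_split /=; apply: eq_bigr => n _.
  rewrite -sqr_line; apply: eq_bigr => k _.
  by rewrite layer_affine addrAC.
have regE : \sum_i (v + t *: dv) i 0 ^+ 2 =
    \sum_i v i 0 ^+ 2 + t * \sum_i 2 * v i 0 * dv i 0 +
    t ^+ 2 * \sum_i dv i 0 ^+ 2.
  by rewrite -sqr_line; apply: eq_bigr => i _; rewrite !mxE.
rewrite !ObarE lossE regE /Obar_slope /Obar_curvature.
by ring.
Qed.

Lemma Opp_vline w v u dv t : Opp w (v + t *: dv) u =
  Opp w v u + t * (Obar_slope v dv + dot (beta_vec N d beta) dv) +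
  t ^+ 2 * Obar_curvature dv.
Proof.
rewrite /Defs.Opp Obar_line !dotD dotZ.
by ring.
Qed.

Lemma dot_delta n (a : 'cV[R]_n) i : dot a (delta_mx i 0) = a i 0.
Proof.
rewrite /dot (bigD1 i) //= big1 ?addr0 => [|j ji]; rewrite mxE.
  by rewrite !eqxx mulr1.
by rewrite (negPf ji) mulr0.
Qed.

Lemma Opp_ucoord w v u i t : Opp w v (u + t *: delta_mx i 0) =
  Opp w v u - beta_vec N d beta i 0 * (leaky (u i 0 + t) - leaky (u i 0)).
Proof.
set c := leaky _ - leaky _.
have sigmaE : sigma alpha (u + t *: delta_mx i 0) =
    sigma alpha u + c *: delta_mx i 0.
  apply/colP => j; rewrite !mxE eqxx andbT.
  case: eqP => [->|_]; last by rewrite !mulr0 !addr0.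
  by rewrite !mulr1 /c subrKC.
have vE : v - sigma alpha (u + t *: delta_mx i 0) =
    v - sigma alpha u + (- c) *: delta_mx i 0.
  by rewrite sigmaE opprD addrA scaleNr.
rewrite /Defs.Opp vE (dotD _ _ (_ *: _)) dotZ dot_delta.
by ring.
Qed.

Lemma grad_Obar w v i :
  grad (Obar w) v i 0 = Obar_slope v (delta_mx i 0).
Proof.
rewrite mxE; have [_ e] := is_derive_quadratic (Obar_line w v (delta_mx i 0)).
exact: e.
Qed.

Definition penalized_objective z := Opp (wpart z) (vpart z) (upart z).

Lemma regular_subgradient_b x g (b : 'cV[R]_(bdim L d)) :
  regular_subdifferential penalized_objective x g -> dot (bpart g) b = 0.
Proof.
move=> /(@regular_subgradient_quadratic _ _ _ x (zvec 0 b 0 0) g 0 0).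
rewrite dot_zvec !dot0 !addr0 add0r; apply; apply: (@filterE _ (nbhs (0 : R)) _) => t.
rewrite /penalized_objective !zpartD !zpartE.
by rewrite !scaler0 !addr0 !mulr0 !addr0.
Qed.

Lemma regular_subgradient_v x g dv :
  regular_subdifferential penalized_objective x g ->
  dot (vpart g) dv = Obar_slope (vpart x) dv + dot (beta_vec N d beta) dv.
Proof.
move=> /(@regular_subgradient_quadratic _ _ _ x (zvec 0 0 dv 0) g
  (Obar_slope (vpart x) dv + dot (beta_vec N d beta) dv) (Obar_curvature dv)).
rewrite dot_zvec !dot0 addr0 !add0r; apply; apply: (@filterE _ (nbhs (0 : R)) _) => t.
rewrite /penalized_objective !zpartD !zpartE.
by rewrite !scaler0 !addr0 Opp_vline.
Qed.

Lemma leaky_pos (t : R) : 0 <= t -> leaky t = t.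
Proof. by move=> t0; apply: max_l; rewrite ler_piMl // ltW. Qed.

Lemma leaky_neg (t : R) : t <= 0 -> leaky t = alpha * t.
Proof.
move=> t0; apply: max_r; rewrite -subr_ge0 -[X in _ - X]mul1r -mulrBl.
by rewrite mulr_le0 // subr_le0 ltW.
Qed.

Lemma beta_vec_gt0 i : 0 < beta_vec N d beta i 0.
Proof. by rewrite mxE mxE; exact: beta_gt0. Qed.

(** At a kink [u i = 0] the penalty [- beta_i sigma(u_i)] is strictly concave
    along the coordinate: the slope [- beta_i] to the right and
    [alpha beta_i] to the left leave no room for a regular subgradient. *)
Lemma regular_subgradient_u x g i :
  regular_subdifferential penalized_objective x g ->
  (0 < upart x i 0 /\ upart g i 0 = - beta_vec N d beta i 0) \/
  (upart x i 0 < 0 /\ upart g i 0 = - (alpha * beta_vec N d beta i 0)).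
Proof.
set B := beta_vec N d beta i 0 => gx.
have B0 : 0 < B := beta_vec_gt0 i.
have line s t : penalized_objective (x + t *: zvec 0 0 0 (s *: delta_mx i 0)) =
    penalized_objective x - B * (leaky (upart x i 0 + t * s) - leaky (upart x i 0)).
  rewrite /penalized_objective !zpartD !zpartE !scaler0 !addr0 scalerA.
  exact: Opp_ucoord.
have gdot s : dot g (zvec 0 0 0 (s *: delta_mx i 0)) = s * upart g i 0.
  by rewrite dot_zvec !dot0 !add0r dotZ dot_delta.
have cvg_line : upart x i 0 + t * 1 @[t --> (0 : R)] --> upart x i 0.
  exact: affine_cvg.
have [u_lt0|u_gt0|u0] := ltgtP (upart x i 0) 0.
- right; split => //; rewrite -[LHS]mul1r -gdot.
  apply: (regular_subgradient_quadratic (q := 0) gx).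
  have ul := cvgr_lt _ cvg_line _ u_lt0; apply: filterS (ul _) => t ut.
  by rewrite line !leaky_neg ?ltW //; ring.
- left; split => //; rewrite -[LHS]mul1r -gdot.
  apply: (regular_subgradient_quadratic (q := 0) gx).
  have ul := cvgr_gt _ cvg_line _ u_gt0; apply: filterS (ul _) => t ut.
  by rewrite line !leaky_pos ?ltW //; ring.
have slope_pos : upart g i 0 <= - B.
  rewrite -[leLHS]mul1r -gdot; apply: (regular_subgradient_slope gx).
  have cst_cvg : (fun _ : R => - B) @ 0^'+ --> - B by exact: cvg_cst.
  apply: cvg_trans cst_cvg; apply: near_eq_cvg.
  have := nbhs_right_gt (0 : R); apply: filterS => t t0.
  rewrite line u0 add0r mulr1 !leaky_pos // ?ltW //.
  by field; rewrite gt_eqF.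
have slope_neg : - upart g i 0 <= alpha * B.
  rewrite -mulN1r -gdot; apply: (regular_subgradient_slope gx).
  have cst_cvg : (fun _ : R => alpha * B) @ 0^'+ --> alpha * B by exact: cvg_cst.
  apply: cvg_trans cst_cvg; apply: near_eq_cvg.
  have := nbhs_right_gt (0 : R); apply: filterS => t t0.
  rewrite line u0 add0r mulrN1 (@leaky_neg (- t)) ?oppr_le0 ?ltW // leaky_pos //.
  by field; rewrite gt_eqF.
have aB : alpha * B < B by rewrite gtr_pMl.
by exfalso; lra.
Qed.

(** The restriction of a regular subgradient to the slice through [x] in which
    only [w] varies; there the objective is [R1] up to a constant. *)
Lemma regular_subgradient_w x g :
  regular_subdifferential penalized_objective x g ->
  regular_subdifferential (R1 lambda_w) (wpart x) (wpart g).
Proof.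
move=> gx e e0.
pose emb w := zvec w (bpart x) (vpart x) (upart x).
have embB w : emb w - x = col_mx (w - wpart x) 0.
  have xE : x = emb (wpart x) by rewrite /emb zvecK.
  by rewrite [X in emb w - X]xE /emb /zvec !opp_col_mx !add_col_mx !subrr
    !col_mx0.
have emb_cvg : emb w @[w --> wpart x] --> x.
  rewrite -[X in _ --> X]zvecK; apply: (@cvg_mx _ _ (nbhs (wpart x))) => i j.
  rewrite /emb /zvec; case: (split_ordP i) => k ->.
    rewrite col_mxEu; under eq_fun do rewrite col_mxEu.
    exact: coord_continuous.
  rewrite col_mxEd; under eq_fun do rewrite col_mxEd.
  exact: (@cst_continuous _ R).
have near_emb : \forall w \near wpart x, penalized_objective x +
    dot g (emb w - x) - e * enorm (emb w - x) <= penalized_objective (emb w).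
  exact: emb_cvg _ (gx e e0).
apply: filterS near_emb => w; rewrite embB dot_col_mx dot0 addr0.
have -> : enorm (col_mx (w - wpart x) (0 : 'cV[R]_(bdim L d + (m + m)))) =
    enorm (w - wpart x).
  rewrite /enorm; congr Num.sqrt; rewrite big_split_ord /= [X in _ + X]big1.
    by rewrite addr0; apply: eq_bigr => i _; rewrite !big_ord1 col_mxEu.
  by move=> i _; rewrite big_ord1 col_mxEd mxE expr0n.
rewrite /penalized_objective /emb !zpartE /Defs.Opp /Defs.Obar -/(wpart g).
by lra.
Qed.

Lemma R1_cvg T (F : set_system T) {FF : Filter F}
    (f : T -> 'cV[R]_(wdim L d)) w :
  f @ F --> w -> R1 lambda_w (f t) @[t --> F] --> R1 lambda_w w.
Proof.
move=> fw; apply: cvgM; first exact: cvg_cst.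
apply: cvg_sumr => l; apply: cvg_sumr => j.
have c_cvg : col j (weight (f t) l) @[t --> F] --> col j (weight w l).
  apply: cvg_mx => k o; rewrite mxE; under eq_fun do rewrite mxE.
  exact: weight_cvg.
exact: (cvg_comp _ _ c_cvg (@enorm_continuous _ _ _ _)).
Qed.

Lemma Obar_slope_cvg T (F : set_system T) {FF : Filter F}
    (f : T -> 'cV[R]_m) v dv :
  f @ F --> v -> Obar_slope (f t) dv @[t --> F] --> Obar_slope v dv.
Proof.
move=> fv; apply: cvgD; apply: cvgM; try exact: cvg_cst.
  apply: cvg_sumr => n; apply: cvg_sumr => k.
  apply: cvgM; last exact: cvg_cst.
  apply: cvgM; first exact: cvg_cst.
  by apply: cvgB; [exact: layer_cvg|exact: cvg_cst].
apply: cvg_sumr => i; apply: cvgM; last exact: cvg_cst.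
by apply: cvgM; [exact: cvg_cst|exact: cvg_coord].
Qed.

(** The [u]-component keeps only the two extreme slopes, because regular
    subgradients exist only off the kinks. *)
Lemma limiting_subgradient z g :
  limiting_subdifferential penalized_objective z g ->
  [/\ limiting_subdifferential (R1 lambda_w) (wpart z) (wpart g),
      bpart g = 0,
      forall dv, dot (vpart g) dv =
        Obar_slope (vpart z) dv + dot (beta_vec N d beta) dv
    & forall i,
      (0 <= upart z i 0 /\ upart g i 0 = - beta_vec N d beta i 0) \/
      (upart z i 0 <= 0 /\ upart g i 0 = - (alpha * beta_vec N d beta i 0))].
Proof.
move=> [xs [gs [xs_cvg _ gs_sub gs_cvg]]]; split.
- exists (fun k => wpart (xs k)), (fun k => wpart (gs k)); split.
  + exact: wpart_cvg.
  + exact: R1_cvg (wpart_cvg xs_cvg).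
  + by move=> k; exact: regular_subgradient_w.
  + exact: wpart_cvg.
- apply/colP => i; rewrite -(dot_delta (bpart g)) mxE.
  have b_cvg : dot (bpart (gs k)) (delta_mx i 0) @[k --> \oo] -->
      dot (bpart g) (delta_mx i 0).
    by apply: cvg_dot; [exact: bpart_cvg|exact: cvg_cst].
  apply: (cvg_unique _ b_cvg) => //.
  have -> : (fun k => dot (bpart (gs k)) (delta_mx i 0)) = fun=> 0.
    by apply/funext => k; exact: regular_subgradient_b (gs_sub k).
  exact: cvg_cst.
- move=> dv; have v_cvg : dot (vpart (gs k)) dv @[k --> \oo] --> dot (vpart g) dv.
    by apply: cvg_dot; [exact: vpart_cvg|exact: cvg_cst].
  apply: (cvg_unique _ v_cvg) => //.
  have -> : (fun k => dot (vpart (gs k)) dv) = fun k =>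
      Obar_slope (vpart (xs k)) dv + dot (beta_vec N d beta) dv.
    by apply/funext => k; exact: regular_subgradient_v (gs_sub k).
  apply: cvgD; last exact: cvg_cst.
  exact: Obar_slope_cvg (vpart_cvg xs_cvg).
move=> i; set B := beta_vec N d beta i 0.
have B0 : 0 < B := beta_vec_gt0 i.
have u_cvg : upart (xs k) i 0 @[k --> \oo] --> upart z i 0.
  exact: cvg_coord (upart_cvg xs_cvg).
have g_cvg : upart (gs k) i 0 @[k --> \oo] --> upart g i 0.
  exact: cvg_coord (upart_cvg gs_cvg).
have closed0 (f : nat -> R) a : f @ \oo --> a -> (forall k, f k = 0) -> a = 0.
  move=> fa f0; apply: (cvg_unique _ fa) => //.
  have -> : f = fun=> 0 by apply/funext.
  exact: cvg_cst.
have c_cvg (c : R) : c @[_ --> \oo] --> c by exact: cvg_cst.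
(* The alternative at the points [xs k] is rewritten as polynomial identities,
   which pass to the limit. *)
have e1 : (upart g i 0 + B) * (upart g i 0 + alpha * B) = 0.
  apply: (closed0 (fun k =>
    (upart (gs k) i 0 + B) * (upart (gs k) i 0 + alpha * B))).
    exact: (cvgM (cvgD g_cvg (c_cvg _)) (cvgD g_cvg (c_cvg _))).
  by move=> k; have [[_ ->]|[_ ->]] := regular_subgradient_u i (gs_sub k);
    rewrite -/B addNr ?mul0r ?mulr0.
have e2 : (upart g i 0 + B) * (upart z i 0 + `|upart z i 0|) = 0.
  apply: (closed0 (fun k =>
    (upart (gs k) i 0 + B) * (upart (xs k) i 0 + `|upart (xs k) i 0|))).
    exact: (cvgM (cvgD g_cvg (c_cvg _)) (cvgD u_cvg (cvg_norm u_cvg))).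
  move=> k; have [[_ ->]|[u0 _]] := regular_subgradient_u i (gs_sub k).
    by rewrite -/B addNr mul0r.
  by rewrite ltr0_norm // subrr mulr0.
have e3 : (upart g i 0 + alpha * B) * (upart z i 0 - `|upart z i 0|) = 0.
  apply: (closed0 (fun k => (upart (gs k) i 0 + alpha * B) *
    (upart (xs k) i 0 - `|upart (xs k) i 0|))).
    exact: (cvgM (cvgD g_cvg (c_cvg _)) (cvgB u_cvg (cvg_norm u_cvg))).
  move=> k; have [[u0 _]|[_ ->]] := regular_subgradient_u i (gs_sub k).
    by rewrite gtr0_norm // subrr mulr0.
  by rewrite -/B addNr mul0r.
have aB : alpha * B < B by rewrite gtr_pMl.
have [gB|gB] := eqVneq (upart g i 0 + B) 0.
  left; split; last by apply/eqP; rewrite -addr_eq0 gB.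
  move/eqP: e3; rewrite mulf_eq0 => /orP[/eqP|/eqP]; first by lra.
  by case: (ler0P (upart z i 0)) => u0; lra.
right; move/eqP: e1; rewrite mulf_eq0 (negPf gB) /= addr_eq0 => /eqP gE.
split => //; move/eqP: e2; rewrite mulf_eq0 (negPf gB) /= => /eqP.
by case: (ler0P (upart z i 0)) => u0; lra.
Qed.

End Objective.

(** * Size of the forward response *)

Section WeightBounds.
Variable R : realType.

Definition entry_sum p q (A : 'M[R]_(p, q)) : R := \sum_j \sum_i `|A i j|.

Lemma entry_sum_ge0 p q (A : 'M[R]_(p, q)) : 0 <= entry_sum A.
Proof. by rewrite sumr_ge0 // => j _; rewrite sumr_ge0. Qed.

Lemma entry_sum0 p q : entry_sum (0 : 'M[R]_(p, q)) = 0.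
Proof.
by rewrite /entry_sum big1 // => j _; rewrite big1 // => i _; rewrite mxE normr0.
Qed.

Lemma entry_sum_mul p q r (A : 'M[R]_(p, q)) (B : 'M[R]_(q, r)) (c : R) :
  (forall j, \sum_i `|A i j| <= c) -> entry_sum (A *m B) <= c * entry_sum B.
Proof.
move=> Ac; rewrite /entry_sum mulr_sumr; apply: ler_sum => n _.
apply: (@le_trans _ _ (\sum_i \sum_j `|A i j| * `|B j n|)).
  apply: ler_sum => i _; rewrite mxE; apply: le_trans (ler_norm_sum _ _ _) _.
  by apply: ler_sum => j _; rewrite normrM.
rewrite exchange_big mulr_sumr; apply: ler_sum => j _ /=.
by rewrite -mulr_suml ler_wpM2r.
Qed.

Variables (L N : nat) (d : nat -> nat).

Lemma R1_ge0 lambda_w (w : 'cV[R]_(wdim L d)) : 0 <= lambda_w ->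
  0 <= R1 lambda_w w.
Proof.
move=> lw0; rewrite mulr_ge0 // sumr_ge0 // => l _; rewrite sumr_ge0 // => j _.
exact: enorm_ge0.
Qed.

(** This is where the factor [sqrt (bdim + d 0)] of [theta_w] is used: it pays
    for comparing the 1-norm of a column with its Euclidean norm, and makes
    [theta_w] an operator bound of every weight matrix for the 1-norm. *)
Lemma weight_col_sum lambda_w theta (w : 'cV[R]_(wdim L d)) l j :
  0 < lambda_w -> R1 lambda_w w <= theta ->
  \sum_i `|weight w l i j| <= theta_w L d lambda_w theta.
Proof.
move=> lw0 Rtheta.
have col_le : enorm (col j (weight w l)) <= theta / lambda_w.
  rewrite ler_pdivlMr // mulrC; apply: le_trans Rtheta.
  rewrite ler_pM2l // (bigD1 l) //= (bigD1 j) //= -addrA lerDl.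
  rewrite addr_ge0 // sumr_ge0 // => *; first exact: enorm_ge0.
  by rewrite sumr_ge0 // => *; exact: enorm_ge0.
have := sum_le_enorm (col j (weight w l)).
under eq_bigr do rewrite mxE.
move=> /le_trans; apply; rewrite mulrC /theta_w.
apply: ler_pM => //; [exact: enorm_ge0|exact: sqrtr_ge0|].
rewrite ler_wsqrtr // ler_nat /bdim (bigD1 l) //= -addnA.
exact: leq_addr.
Qed.

Lemma block_Psi (v : 'cV[R]_(vdim L N d)) w l :
  block (Psi 0 v *m w) l = weight w l *m layer 0 v (ltnW (ltn_ord l)).
Proof.
apply/matrixP => k n; apply: (etrans (blockE _ k n)).
by apply: (etrans (preactE 0 v w k n)); rewrite mxE.
Qed.

End WeightBounds.

Section ResponseBounds.
Variables (R : realType) (L N : nat) (d : nat -> nat).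
Local Notation m := (vdim L N d).
Variables (w : 'cV[R]_(wdim L d)) (tw : R).
Hypothesis w_bounded : forall l j, \sum_i `|weight w l i j| <= tw.
Hypothesis tw_ge0 : 0 <= tw.
Variables (l0 : 'I_L) (k0 : 'I_(d l0.+1)) (n0 : 'I_N).
Variable v : 'cV[R]_m.
Hypothesis v_response : response w (- delta_mx (neuron k0 n0) 0) v = v.
Local Notation u := (Psi 0 v *m w).
Local Notation M := (Num.max tw 1).

Let M_ge1 : 1 <= M. Proof. by rewrite le_max lexx orbT. Qed.
Let tw_leM : tw <= M. Proof. by rewrite le_max lexx. Qed.

Lemma decreasing_responseE i : v i 0 = `|u i 0| - (i == neuron k0 n0)%:R.
Proof.
by rewrite -[in LHS]v_response responseE !mxE eqxx andbT.
Qed.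

Lemma entry_sum_source (l : 'I_L) :
  \sum_n \sum_(k < d l.+1) (neuron k n == neuron k0 n0 :> 'I_m)%:R <=
    (l == l0)%:R :> R.
Proof.
have [->|ll0] := eqVneq l l0; last first.
  rewrite big1 // => n _; rewrite big1 // => k _; case: eqP => // /neuron_inj e.
  by rewrite e eqxx in ll0.
have := sum_neuron (fun i : 'I_m => (i == neuron k0 n0)%:R : R).
rewrite (bigD1 (neuron k0 n0)) //= eqxx big1 => [|i /negPf ->] //.
rewrite addr0 => ->; rewrite (bigD1 l0) //= lerDl sumr_ge0 // => l' _.
by rewrite sumr_ge0 // => n _; rewrite sumr_ge0.
Qed.

Lemma entry_sum_response (l : 'I_L) :
  entry_sum (block v l) <= entry_sum (block u l) + (l == l0)%:R.
Proof.
apply: le_trans (lerD (lexx _) (entry_sum_source l)).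
rewrite /entry_sum -big_split; apply: ler_sum => n _ /=.
rewrite -big_split; apply: ler_sum => k _ /=.
rewrite (blockE v) (blockE u) decreasing_responseE.
apply: le_trans (ler_normB _ _) _; rewrite normr_id lerD2l ger0_norm //.
Qed.

(** The perturbation enters at layer [l0] with size one, and each later layer
    multiplies its entrywise 1-norm by at most [tw].  The increments of [u] at
    layer [l] see the increments of [v] at the preceding layer, hence the
    exponent [l - l0 - 1]. *)
Lemma response_bound (l : 'I_L) :
  entry_sum (block u l) <=
    (if (l <= l0)%N then 0 else tw * M ^+ (l - l0 - 1)) /\
  entry_sum (block v l) <= (if (l < l0)%N then 0 else M ^+ (l - l0)).
Proof.
case: l => l; elim: l => [|l IH] lL.
  have u_le0 : entry_sum (block u (Ordinal lL)) <= 0.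
    by rewrite block_Psi /= mulmx0 entry_sum0.
  split; first by rewrite leq0n.
  apply: le_trans (entry_sum_response _) _; rewrite -val_eqE /=.
  case: (posnP l0) => [->|l0_gt0]; rewrite ?ltnn ?subnn ?expr0 ?l0_gt0 /=.
    by rewrite gerDr.
  by rewrite (ltn_eqF l0_gt0) addr0.
have [_ IHv] := IH (ltnW lL).
have u_le : entry_sum (block u (Ordinal lL)) <=
    (if (l.+1 <= l0)%N then 0 else tw * M ^+ (l.+1 - l0 - 1)).
  have mul_le := @entry_sum_mul R _ _ _ (weight w (Ordinal lL))
    (layer 0 v (ltnW (ltn_ord (Ordinal lL)))) tw (w_bounded (l := _)).
  rewrite block_Psi; apply: (le_trans mul_le).
  rewrite /= (bool_irrelevance (ltnW _) (ltnW lL)).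
  apply: (le_trans (ler_wpM2l tw_ge0 IHv)) => /=.
  case: ifP => [_|_]; first by rewrite mulr0.
  by rewrite subnAC subn1.
split => //; apply: le_trans (entry_sum_response _) _; rewrite -val_eqE /=.
move: u_le => /=; case: (ltngtP l.+1 l0) => [ll0|ll0|ll0] u_le.
- by rewrite addr0.
- rewrite addr0; apply: le_trans u_le _.
  have -> : (l.+1 - l0)%N = (l.+1 - l0 - 1).+1 by rewrite subn1 prednK // subn_gt0.
  by rewrite subSS subn0 exprS ler_wpM2r // exprn_ge0 // (le_trans ler01).
- have -> : (l.+1 - l0 = 0)%N by rewrite -ll0 subnn.
  by rewrite expr0 gerDr.
Qed.

Lemma enorm_response : enorm v <= L%:R * M ^+ L.
Proof.
apply: le_trans (enorm_le_sum v) _; rewrite sum_neuron.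
rewrite -[L in L%:R]card_ord mulr_natl -sumr_const; apply: ler_sum => l _.
have [_] := response_bound l; rewrite /entry_sum.
under eq_bigr do under eq_bigr do rewrite blockE.
move=> /le_trans; apply; case: ifP => _; first by rewrite exprn_ge0 // (le_trans ler01).
by rewrite ler_weXn2l // (leq_trans (leq_subr _ _)) // ltnW.
Qed.

Lemma weighted_response (beta : 'I_L -> R) : (forall l, 0 <= beta l) ->
  \sum_i beta_vec N d beta i 0 * `|u i 0| <=
  \sum_(j < L | (l0 < j)%N) beta j * tw * M ^+ (j - l0 - 1).
Proof.
move=> beta_ge0; rewrite sum_neuron [leRHS]big_mkcond /=; apply: ler_sum => l _.
have -> : \sum_n \sum_(k < d l.+1)
      beta_vec N d beta (neuron k n) 0 * `|u (neuron k n) 0| =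
    beta l * entry_sum (block u l).
  rewrite /entry_sum mulr_sumr; apply: eq_bigr => n _.
  rewrite mulr_sumr; apply: eq_bigr => k _.
  by rewrite beta_vecE (blockE u).
have [u_le _] := response_bound l.
apply: (le_trans (ler_wpM2l (beta_ge0 l) u_le)).
by case: (leqP l l0) => _; rewrite ?mulr0 // mulrA.
Qed.

End ResponseBounds.

(** * Components of the Lagrangian slope *)

Section LagrangianSlope.
Variables (R : realType) (L N : nat) (d : nat -> nat).
Variables (X : 'M[R]_(d 0%N, N)) (alpha : R).
Local Notation m := (vdim L N d).
Local Notation zspace := 'cV[R]_(zdim L N d).
Implicit Types (z dz : zspace) (mu xi v u : 'cV[R]_m).

Lemma Psi0_mul (w : 'cV[R]_(wdim L d)) : Psi 0 (0 : 'cV[R]_m) *m w = 0.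
Proof.
have := Psi_affine 0 (0 : 'cV[R]_m) 0 (-1) w.
rewrite scaler0 addr0 scaleN1r => e.
by rewrite e subrr.
Qed.

Lemma lagrangian_slope_zvec mu1 mu2 xi z w b v u :
  lagrangian_slope X alpha mu1 mu2 xi z (zvec w b v u) =
  dot xi u - (dot xi (Psi X (vpart z) *m w) + dot xi (Psi 0 v *m wpart z) +
    dot xi (Amx *m b)) -
  (dot mu1 v - dot mu1 u + (dot mu2 v - alpha * dot mu2 u)).
Proof.
have s1 : \sum_i mu1 i 0 * slack alpha (inl i) (zvec w b v u) =
    dot mu1 v - dot mu1 u.
  by rewrite /dot -sumrB; apply: eq_bigr => i _; rewrite /= !zpartE mulrBr.
have s2 : \sum_i mu2 i 0 * slack alpha (inr i) (zvec w b v u) =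
    dot mu2 v - alpha * dot mu2 u.
  rewrite /dot mulr_sumr -sumrB; apply: eq_bigr => i _ /=.
  by rewrite !zpartE mulrBr mulrCA.
have s3 : \sum_j xi j 0 * residual_slope X j z (zvec w b v u) =
    dot xi u - (dot xi (Psi X (vpart z) *m w) + dot xi (Psi 0 v *m wpart z) +
    dot xi (Amx *m b)).
  rewrite /dot -!big_split -sumrB; apply: eq_bigr => j _.
  by rewrite /residual_slope !zpartE mulrBr !mulrDr.
by rewrite /lagrangian_slope s1 s2 s3.
Qed.

Lemma lagrangian_slopeN mu1 mu2 xi z dz :
  lagrangian_slope X alpha mu1 mu2 xi z (- dz) =
  - lagrangian_slope X alpha mu1 mu2 xi z dz.
Proof.
have PsiN (v : 'cV[R]_m) (w : 'cV[R]_(wdim L d)) :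
    Psi 0 (- v) *m w = - (Psi 0 v *m w).
  have vE : - v = 0 + (-1) *: v by rewrite add0r scaleN1r.
  have addN (x a b : 'cV[R]_m) : x = a + (-1) *: b -> a = 0 -> x = - b.
    by move=> -> ->; rewrite add0r scaleN1r.
  have := Psi_affine 0 0 v (-1) w; rewrite -vE => e.
  exact: addN e (Psi0_mul w).
have dzE : - dz = zvec (- wpart dz) (- bpart dz) (- vpart dz) (- upart dz).
  by rewrite -{1}(zvecK dz) /zvec !opp_col_mx.
have eN := lagrangian_slope_zvec mu1 mu2 xi z (- wpart dz) (- bpart dz)
  (- vpart dz) (- upart dz).
have eP := lagrangian_slope_zvec mu1 mu2 xi z (wpart dz) (bpart dz)
  (vpart dz) (upart dz).
rewrite zvecK in eP.
have d1 := etrans (congr1 (dot xi) (mulmxN (Psi X (vpart z)) (wpart dz))) (dotN _ _).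
have d2 := etrans (congr1 (dot xi) (PsiN (vpart dz) (wpart z))) (dotN _ _).
have d3 := etrans (congr1 (dot xi) (mulmxN Amx (bpart dz))) (dotN _ _).
rewrite dzE; apply: (etrans eN); apply: etrans (esym (congr1 -%R eP)).
have negate (r a b c e p q s t a' b' c' e' p' q' s' t' : R) :
    a' = - a -> b' = - b -> c' = - c -> e' = - e -> p' = - p -> q' = - q ->
    s' = - s -> t' = - t ->
    a' - (b' + c' + e') - (p' - q' + (s' - r * t')) =
    - (a - (b + c + e) - (p - q + (s - r * t))).
  by move=> -> -> -> -> -> -> -> ->; ring.
exact: negate (dotN _ _) d1 d2 d3 (dotN _ _) (dotN _ _) (dotN _ _) (dotN _ _).
Qed.

Lemma dot_trmx p q (M : 'M[R]_(p, q)) (x : 'cV[R]_p) (y : 'cV[R]_q) :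
  dot x (M *m y) = dot (M^T *m x) y.
Proof.
rewrite /dot; under eq_bigr do rewrite mxE mulr_sumr.
rewrite exchange_big; apply: eq_bigr => j _ /=; rewrite mxE mulr_suml.
by apply: eq_bigr => i _; rewrite mxE; ring.
Qed.

Lemma lagrangian_slope_w mu1 mu2 xi z w :
  lagrangian_slope X alpha mu1 mu2 xi z (zvec w 0 0 0) =
  - dot ((Psi X (vpart z))^T *m xi) w.
Proof.
rewrite lagrangian_slope_zvec Psi0_mul mulmx0 !dot0 dot_trmx.
by move: (dot _ w) => a; ring.
Qed.

Lemma lagrangian_slope_b mu1 mu2 xi z b :
  lagrangian_slope X alpha mu1 mu2 xi z (zvec 0 b 0 0) = - dot (Amx^T *m xi) b.
Proof.
rewrite lagrangian_slope_zvec Psi0_mul mulmx0 !dot0 dot_trmx.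
by move: (dot _ b) => a; ring.
Qed.

Lemma lagrangian_slope_v mu1 mu2 xi z v :
  lagrangian_slope X alpha mu1 mu2 xi z (zvec 0 0 v 0) =
  - dot xi (Psi 0 v *m wpart z) - dot mu1 v - dot mu2 v.
Proof.
rewrite lagrangian_slope_zvec !mulmx0 !dot0.
by move: (dot xi _) (dot mu1 _) (dot mu2 _) => a b c; ring.
Qed.

Lemma lagrangian_slope_u mu1 mu2 xi z u :
  lagrangian_slope X alpha mu1 mu2 xi z (zvec 0 0 0 u) =
  dot xi u + dot mu1 u + alpha * dot mu2 u.
Proof.
rewrite lagrangian_slope_zvec Psi0_mul !mulmx0 !dot0.
by move: (dot xi _) (dot mu1 _) (dot mu2 _) => a b c; ring.
Qed.

End LagrangianSlope.

(** * Exactness of the penalty *)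

Section ExactPenalty.
Variables (R : realType) (L N : nat) (d : nat -> nat).
Variables (X : 'M[R]_(d 0%N, N)) (Y : 'M[R]_(d L, N)).
Variables (alpha lambda_w lambda_v theta LO : R) (beta : 'I_L -> R).
Hypotheses (alpha_gt0 : 0 < alpha) (alpha_lt1 : alpha < 1).
Hypothesis beta_gt0 : forall l, 0 < beta l.
Hypothesis LO_lipschitz :
  lipschitz_constant (Omega_theta X Y alpha lambda_w lambda_v beta theta)
    (Obar X Y lambda_w lambda_v) LO.
Local Notation m := (vdim L N d).
Local Notation zspace := 'cV[R]_(zdim L N d).
Local Notation Obar := (Obar X Y lambda_w lambda_v).
Local Notation objective :=
  (penalized_objective X Y alpha lambda_w lambda_v beta).
Local Notation leaky t := (Num.max t (alpha * t)).
Implicit Types (z dz g h : zspace) (v u : 'cV[R]_m).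

Lemma leaky_lower (a b : R) : leaky a - `|b| <= leaky (a + b).
Proof.
have b1 : - b <= `|b| by rewrite -normrN ler_norm.
have b2 : - (alpha * b) <= `|b|.
  rewrite (le_trans (ler_norm _)) // normrN normrM gtr0_norm // ler_piMl //.
  exact: ltW.
rewrite lerBlDr ge_max; apply/andP; split.
  have : a + b <= leaky (a + b) by rewrite le_max lexx.
  by lra.
have : alpha * (a + b) <= leaky (a + b) by rewrite le_max lexx orbT.
by rewrite mulrDr; lra.
Qed.

(** Along [dz = (0, 0, dv, du)] the objective is quadratic except for the
    activation, which is 1-Lipschitz. *)
Lemma objective_line_le z dv du t : 0 <= t ->
  objective (z + t *: zvec 0 0 dv du) <= objective z + t *
    (Obar_slope X Y lambda_v (vpart z) dv +
     (dot (beta_vec N d beta) dv + \sum_i beta_vec N d beta i 0 * `|du i 0|)) +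
    t ^+ 2 * Obar_curvature lambda_v dv.
Proof.
move=> t0; set B := beta_vec N d beta.
rewrite /penalized_objective !zpartD !zpartE !scaler0 !addr0 Opp_vline.
have sigma_le : dot B (sigma alpha (upart z)) - t * \sum_i B i 0 * `|du i 0| <=
    dot B (sigma alpha (upart z + t *: du)).
  rewrite /dot mulr_sumr -sumrB; apply: ler_sum => i _.
  have -> : sigma alpha (upart z + t *: du) i 0 = leaky (upart z i 0 + t * du i 0).
    by rewrite !mxE.
  have -> : sigma alpha (upart z) i 0 = leaky (upart z i 0) by rewrite mxE.
  have -> : t * (B i 0 * `|du i 0|) = B i 0 * `|t * du i 0|.
    by rewrite normrM (ger0_norm t0) mulrCA.
  by rewrite -mulrBr ler_wpM2l ?leaky_lower // ltW // beta_vec_gt0.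
rewrite /Defs.Opp -/B !dotD !dotN.
set S := \sum_i _ in sigma_le *.
by rewrite !mulrDr; lra.
Qed.

Lemma slack_dominated_ge0 (i : 'I_m + 'I_m) w b v u :
  (let k := match i with inl k => k | inr k => k end in v k 0 = `|u k 0|) ->
  0 <= slack alpha i (zvec w b v u).
Proof.
case: i => k /= vk; rewrite /slack !zpartE vk.
  by have [] := slope_dominates alpha_gt0 alpha_lt1 (u k 0) 0; rewrite addr0.
by have [] := slope_dominates alpha_gt0 alpha_lt1 (u k 0) 0; rewrite addr0.
Qed.

(** The segment from [z] in the direction of the response to a unit decrease of
    the slack neuron [i0]. *)
Section DescentSegment.
Variable z : zspace.
Hypothesis z_Omega2 : Omega2 X alpha z.
Hypothesis z_lt_theta : objective z < theta.
Variables (l0 : 'I_L) (k0 : 'I_(d l0.+1)) (n0 : 'I_N).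
Local Notation i0 := (neuron k0 n0).
Hypothesis slack1_gt0 : 0 < slack alpha (inl i0) z.
Hypothesis slack2_gt0 : 0 < slack alpha (inr i0) z.
Variable dv : 'cV[R]_m.
Local Notation du := (Psi 0 dv *m wpart z).
Hypothesis dvE : forall i, dv i 0 = `|du i 0| - (i == i0)%:R.
Hypothesis du_i0 : du i0 0 = 0.
Local Notation dz := (zvec 0 0 dv du).

Lemma segment_slack i t : 0 <= t -> t <= slack alpha (inl i0) z ->
  t <= slack alpha (inr i0) z -> 0 <= slack alpha i (z + t *: dz).
Proof.
move=> t0 t1 t2; have [G0 _] : feasible_set (slack alpha) (residual X) z.
  by rewrite -Omega2_feasible_set.
rewrite slack_line.
have dv0 : dv i0 0 = -1 by rewrite dvE du_i0 normr0 eqxx sub0r.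
have [ei|ni] := eqVneq (match i with inl k => k | inr k => k end) i0.
  case: i ei => k /= ->; rewrite !zpartE dv0 du_i0.
    by rewrite subr0 mulrN1 subr_ge0.
  by rewrite mulr0 subr0 mulrN1 subr_ge0.
rewrite addr_ge0 // mulr_ge0 // slack_dominated_ge0 //=.
by rewrite dvE (negPf ni) subr0.
Qed.

Lemma segment_Omega_theta : \forall t \near 0^'+,
  Omega_theta X Y alpha lambda_w lambda_v beta theta (z + t *: dz).
Proof.
have [_ H0] : feasible_set (slack alpha) (residual X) z.
  by rewrite -Omega2_feasible_set.
set C := Obar_slope X Y lambda_v (vpart z) dv +
     (dot (beta_vec N d beta) dv + \sum_i beta_vec N d beta i 0 * `|du i 0|).
set Q := Obar_curvature lambda_v dv.
have bound_cvg : objective z + t * (C + t * Q) @[t --> 0^'+] --> objective z.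
  apply: cvg_at_right_filter.
  have C_cvg : C + t * Q @[t --> (0 : R)] --> C by exact: affine_cvg.
  have id_cvg : (fun t : R => t) @ (0 : R) --> (0 : R) by exact: cvg_id.
  have c_cvg : (fun _ : R => objective z) @ (0 : R) --> objective z by exact: cvg_cst.
  have := cvgD c_cvg (cvgM id_cvg C_cvg).
  by rewrite mul0r addr0 => lim; exact: lim.
have bound_lt := cvgr_lt _ bound_cvg _ z_lt_theta.
have t1 := nbhs_right_le slack1_gt0; have t2 := nbhs_right_le slack2_gt0.
have t_gt0 := nbhs_right_gt (0 : R).
near=> t.
have t0 : 0 < t by near: t.
split.
  rewrite Omega2_feasible_set; split=> [i|j].
    apply: segment_slack; first exact: ltW.
      by near: t.
    by near: t.
  rewrite residual_line H0 residual_slope_zvec0 subrr mulr0 wpart_zvec mulmx0.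
  by rewrite mxE oppr0 mulr0 !addr0.
apply: (le_trans (objective_line_le z dv _ (ltW t0))).
have : objective z + t * (C + t * Q) < theta by near: t; exact: bound_lt.
rewrite -/C -/Q; clearbody C Q => bt.
by apply/ltW; move: bt; rewrite mulrDr expr2 -mulrA addrA.
Unshelve. all: by end_near. Qed.

(** The Lipschitz estimate is available between points of the sublevel set only,
    and bounds the slope because the segment stays there for small [t]. *)
Lemma Obar_slope_segment_le :
  Obar_slope X Y lambda_v (vpart z) dv <= LO * enorm dv.
Proof.
have [LO0 lip] := LO_lipschitz.
set C := Obar_slope X Y lambda_v (vpart z) dv.
set Q := Obar_curvature lambda_v dv.
have C_cvg : C + t * Q @[t --> 0^'+] --> C.
  by apply: cvg_at_right_filter; exact: affine_cvg.
apply: (cvgr_to_le C_cvg).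
have t_gt0 := nbhs_right_gt (0 : R).
move: t_gt0 segment_Omega_theta; apply: filterS2 => t t0 zt.
have z_in : Omega_theta X Y alpha lambda_w lambda_v beta theta z.
  by split => //; exact: ltW.
have := lip _ _ zt z_in.
rewrite !zpartD !zpartE scaler0 addr0 Obar_line.
rewrite opp_col_mx add_col_mx subrr [_ + t *: dv - _]addrAC subrr add0r.
have -> : enorm (col_mx (0 : 'cV[R]_(wdim L d)) (t *: dv)) = t * enorm dv.
  rewrite -[t in t * _](gtr0_norm t0) -enormZ /enorm; congr Num.sqrt.
  rewrite big_split_ord /= big1 ?add0r => [|i _].
    by apply: eq_bigr => i _; rewrite !big_ord1 col_mxEd.
  by rewrite big_ord1 col_mxEu mxE expr0n.
rewrite -/C -/Q => le_t.
have : t * (C + t * Q) <= t * (LO * enorm dv).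
  apply: le_trans (ler_norm _) _.
  rewrite [leRHS]mulrCA; apply: le_trans le_t; rewrite le_eqVlt; apply/orP; left.
  apply/eqP; congr (`| _ |); move: (Obar _ _) => o; clearbody C Q.
  by ring.
by rewrite ler_pM2l.
Qed.

End DescentSegment.

End ExactPenalty.

(** Stationarity with [beta] large makes the penalty exact: were a neuron
    strictly slack, the pairing of [g + h = 0] with the descent direction would
    be negative.  The normal part is nonpositive, since the slacks that carry
    multipliers do not decrease. *)
Lemma stationary_active (R : realType) (L N : nat) (d : nat -> nat)
    (X : 'M[R]_(d 0%N, N)) (Y : 'M[R]_(d L, N))
    (alpha lambda_w lambda_v theta LO : R) (beta : 'I_L -> R)
    (z g h : 'cV[R]_(zdim L N d)) (mu1 mu2 xi : 'cV[R]_(vdim L N d)) :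
  0 < alpha -> alpha < 1 -> 0 < lambda_w -> 0 < lambda_v ->
  (forall l, 0 < beta l) ->
  lipschitz_constant (Omega_theta X Y alpha lambda_w lambda_v beta theta)
    (Obar X Y lambda_w lambda_v) LO ->
  (forall l : 'I_L, let tw := theta_w L d lambda_w theta in
     beta l > L%:R * LO * Num.max tw 1 ^+ L
              + 2 * \sum_(j < L | (l < j)%N)
                      beta j * tw * Num.max tw 1 ^+ (j - l - 1)) ->
  Omega2 X alpha z ->
  penalized_objective X Y alpha lambda_w lambda_v beta z < theta ->
  (forall dv, dot (vpart g) dv =
     Obar_slope X Y lambda_v (vpart z) dv + dot (beta_vec N d beta) dv) ->
  (forall i, `|upart g i 0| <= beta_vec N d beta i 0) ->
  (forall i, 0 <= mu1 i 0 /\ 0 <= mu2 i 0) ->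
  (forall i, mu1 i 0 * slack alpha (inl i) z = 0) ->
  (forall i, mu2 i 0 * slack alpha (inr i) z = 0) ->
  (forall dz, dot h dz <= lagrangian_slope X alpha mu1 mu2 xi z dz) ->
  0 = g + h -> vpart z = sigma alpha (upart z).
Proof.
move=> a0 a1 lw0 lv0 beta0 lip beta_large zO z_theta gv gu mu0 c1 c2 lag gh.
have [G0 _] : feasible_set (slack alpha) (residual X) z.
  by rewrite -Omega2_feasible_set.
have v_ge i : Num.max (upart z i 0) (alpha * upart z i 0) <= vpart z i 0.
  rewrite ge_max; apply/andP; split; rewrite -subr_ge0.
    exact: (G0 (inl i)).
  exact: (G0 (inr i)).
apply/colP; apply: neuronP => l0 k0 n0; set i0 := neuron k0 n0.
rewrite [RHS]mxE; apply/eqP; rewrite eq_le v_ge andbT leNgt; apply/negP.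
rewrite gt_max => /andP[].
rewrite -subr_gt0 => s1; rewrite -subr_gt0 => s2.
set w := wpart z.
have Rw : R1 lambda_w w <= theta.
  apply: le_trans (ltW z_theta).
  rewrite /penalized_objective /Opp ObarE.
  have pen0 : 0 <= dot (beta_vec N d beta) (vpart z - sigma alpha (upart z)).
    rewrite sumr_ge0 // => i _.
    apply: mulr_ge0; first exact/ltW/beta_vec_gt0.
    have -> : (vpart z - sigma alpha (upart z)) i 0 = vpart z i 0 -
      Num.max (upart z i 0) (alpha * upart z i 0) by rewrite !mxE.
    by rewrite subr_ge0.
  have loss0 : 0 <= N%:R^-1 * (\sum_n \sum_k
      (layer X (vpart z) (leqnn L) k n - Y k n) ^+ 2).
    rewrite mulr_ge0 ?invr_ge0 ?ler0n // sumr_ge0 // => n _.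
    by rewrite sumr_ge0 // => k _; exact: sqr_ge0.
  have reg0 : 0 <= lambda_v * \sum_i vpart z i 0 ^+ 2.
    apply: mulr_ge0; first exact: ltW.
    by rewrite sumr_ge0 // => i _; exact: sqr_ge0.
  have le_sum (a b c r : R) : 0 <= a -> 0 <= b -> 0 <= c -> r <= a + r + b + c.
    by lra.
  exact: le_sum.
have theta0 : 0 <= theta := le_trans (R1_ge0 w (ltW lw0)) Rw.
set tw := theta_w L d lambda_w theta.
have tw0 : 0 <= tw.
  by rewrite mulr_ge0 ?sqrtr_ge0 // divr_ge0 // ltW.
have w_bounded l j : \sum_i `|weight w l i j| <= tw.
  exact: weight_col_sum lw0 Rw.
have [dv dv_resp] := exists_response_fixpoint w (- delta_mx i0 0).
have dvE := decreasing_responseE dv_resp.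
set du := Psi 0 dv *m w.
have du_i0 : du i0 0 = 0.
  have [u_le _] := response_bound w_bounded tw0 dv_resp l0.
  move: u_le; rewrite leqnn /entry_sum => u_le.
  have : \sum_j \sum_i `|block du l0 i j| = 0.
    by apply/eqP; rewrite eq_le u_le entry_sum_ge0.
  move=> /eqP; rewrite psumr_eq0 => [/allP/(_ n0 (mem_index_enum _))|n _].
    2: by rewrite sumr_ge0.
  move=> /implyP/(_ isT); rewrite psumr_eq0 // => /allP/(_ k0 (mem_index_enum _)).
  by move=> /implyP/(_ isT); rewrite normr_eq0 (blockE du) => /eqP.
have slope_le := Obar_slope_segment_le a0 a1 beta0 lip zO z_theta s1 s2 dvE du_i0.
have dv_le := enorm_response w_bounded tw0 dv_resp.
have du_le := weighted_response w_bounded tw0 dv_resp (fun l => ltW (beta0 l)).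
have LO0 : 0 <= LO by have [] := lip.
have h_le : dot h (zvec 0 0 dv du) <= 0.
  apply: (le_trans (lag _)); rewrite /lagrangian_slope big1 => [|j _]; last first.
    by rewrite residual_slope_zvec0 subrr mulr0.
  rewrite sub0r oppr_le0 addr_ge0 //; apply: sumr_ge0 => i _.
    have [mu1_0 _] := mu0 i; have [ei|ni] := eqVneq i i0.
      move/eqP: (c1 i0); rewrite mulf_eq0 (gt_eqF s1) orbF => /eqP.
      by rewrite -ei => ->; rewrite mul0r.
    rewrite mulr_ge0 // (slack_dominated_ge0 a0 a1) //=.
    by rewrite dvE (negPf ni) subr0.
  have [_ mu2_0] := mu0 i; have [ei|ni] := eqVneq i i0.
    move/eqP: (c2 i0); rewrite mulf_eq0 (gt_eqF s2) orbF => /eqP.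
    by rewrite -ei => ->; rewrite mul0r.
  rewrite mulr_ge0 // (slack_dominated_ge0 a0 a1) //=.
  by rewrite dvE (negPf ni) subr0.
have g_ge : 0 <= dot g (zvec 0 0 dv du).
  have -> : g = - h by apply/eqP; rewrite -addr_eq0 -gh.
  rewrite /dot; under eq_bigr do rewrite mxE mulNr.
  by rewrite sumrN oppr_ge0.
(* The factor 2: one [beta |du|] comes from [beta dv], the other from the
   [u]-component of the subgradient. *)
have cost_le : dot (beta_vec N d beta) dv + dot (upart g) du <=
    2 * (\sum_i beta_vec N d beta i 0 * `|du i 0|) - beta l0.
  have -> : beta l0 = \sum_i beta_vec N d beta i 0 * (i == i0)%:R.
    rewrite (bigD1 i0) //= big1 => [|i /negPf ->]; last by rewrite mulr0.
    by rewrite eqxx mulr1 addr0 beta_vecE.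
  rewrite /dot -big_split mulr_sumr -sumrB; apply: ler_sum => i _ /=.
  rewrite dvE -/du.
  have : upart g i 0 * du i 0 <= beta_vec N d beta i 0 * `|du i 0|.
    by apply: (le_trans (ler_norm _)); rewrite normrM ler_wpM2r.
  by rewrite mulrBr; lra.
move: g_ge; rewrite dot_zvec !dot0 !add0r gv.
have := beta_large l0; rewrite /= -/tw.
have := ler_wpM2l LO0 dv_le.
move: du_le cost_le slope_le; rewrite -/du -/w.
set S1 := \sum_(j < L | _) _; set S2 := \sum_i _ * _.
set M := Num.max tw 1 ^+ L.
set a := Obar_slope _ _ _ _ _; set b := dot _ dv; set c := dot _ du.
set e := enorm dv; clearbody S1 S2 M a b c e.
have -> : L%:R * LO * M = LO * (L%:R * M) by ring.
by lra.
Qed.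

Theorem theorem11 (R : realType) (L N : nat) (d : nat -> nat)
    (X : 'M[R]_(d 0%N, N)) (Y : 'M[R]_(d L, N))
    (alpha lambda_w lambda_v theta LO : R) (beta : 'I_L -> R)
    (L_gt0 : (0 < L)%N) (N_gt0 : (0 < N)%N)
    (d_gt0 : forall l, (l <= L)%N -> (0 < d l)%N)
    (alpha_gt0 : 0 < alpha) (alpha_lt1 : alpha < 1)
    (lambda_w_gt0 : 0 < lambda_w) (lambda_v_gt0 : 0 < lambda_v)
    (beta_gt0 : forall l, 0 < beta l)
    (theta_gt : N%:R^-1 * enorm Y ^+ 2 < theta)
    (LO_lipschitz :
       lipschitz_constant (Omega_theta X Y alpha lambda_w lambda_v beta theta)
         (Obar X Y lambda_w lambda_v) LO)
    (beta_large : forall l : 'I_L,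
       let tw := theta_w L d lambda_w theta in
       beta l > L%:R * LO * Num.max tw 1 ^+ L
                + 2 * \sum_(j < L | (l < j)%N)
                        beta j * tw * Num.max tw 1 ^+ (j - l - 1))
    (z : 'cV[R]_(zdim L N d))
    (z_Omega2 : Omega2 X alpha z)
    (z_lt_theta :
       Opp X Y alpha lambda_w lambda_v beta (wpart z) (vpart z) (upart z)
         < theta)
    (z_stationary : limiting_stationary_point
       (fun z' => Opp X Y alpha lambda_w lambda_v beta
                    (wpart z') (vpart z') (upart z'))
       (Omega2 X alpha) z) :
  MPCC_W_stationary X Y alpha lambda_w lambda_v z.
Proof.
have [_ [g [h [g_sub h_normal gh]]]] := z_stationary.
have [gw gb gv gu] := limiting_subgradient alpha_lt1 beta_gt0 g_sub.
have [mu1 [mu2 [xi [mu0 c1 c2 lag]]]] :=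
  Omega2_limiting_normal alpha_gt0 alpha_lt1 h_normal.
pose B := beta_vec N d beta.
have B0 i : 0 < B i 0 := beta_vec_gt0 beta_gt0 i.
have gu_bounded i : `|upart g i 0| <= B i 0.
  case: (gu i) => -[_ ->]; rewrite normrN; first by rewrite gtr0_norm ?B0.
  by rewrite gtr0_norm ?mulr_gt0 ?B0 // ler_piMl ?(ltW (B0 i)) ?(ltW alpha_lt1).
have active : vpart z = sigma alpha (upart z).
  exact: (stationary_active alpha_gt0 alpha_lt1 lambda_w_gt0 lambda_v_gt0
    beta_gt0 LO_lipschitz beta_large z_Omega2 z_lt_theta gv gu_bounded mu0 c1 c2
    lag gh).
have lagE dz : dot g dz = - lagrangian_slope X alpha mu1 mu2 xi z dz.
  have -> : g = - h by apply/eqP; rewrite -addr_eq0 -gh.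
  have -> : dot (- h) dz = - dot h dz.
    by rewrite /dot -sumrN; apply: eq_bigr => i _; rewrite mxE mulNr.
  congr (- _); apply/eqP; rewrite eq_le lag /=.
  by have := lag (- dz); rewrite dotN lagrangian_slopeN lerN2.
have vE i : vpart z i 0 = Num.max (upart z i 0) (alpha * upart z i 0).
  by rewrite [in LHS]active mxE.
(* [shift1 + shift2 = beta] cancels the [v]-component of the penalty, and
   [shift1 + alpha * shift2] its [u]-component. *)
pose shift1 : 'cV[R]_(vdim L N d) :=
  \col_i (if upart g i 0 == - B i 0 then B i 0 else 0).
pose shift2 : 'cV[R]_(vdim L N d) :=
  \col_i (if upart g i 0 == - B i 0 then 0 else B i 0).
split; first by split => //; have [] := z_Omega2.
exists (mu1 - shift1), (mu2 - shift2), xi; split.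
- exists (wpart g) => //; apply/colP => i.
  have := lagE (zvec (delta_mx i 0) 0 0 0).
  rewrite lagrangian_slope_w dot_zvec !dot0 !addr0 opprK !dot_delta => e.
  have subE (x y : 'cV[R]_(wdim L d)) : x i 0 = y i 0 -> 0 = (x - y) i 0.
    by move=> xy; rewrite !mxE xy subrr.
  by rewrite [LHS]mxE; exact: subE.
- apply/colP => i; have := lagE (zvec 0 (delta_mx i 0) 0 0).
  rewrite lagrangian_slope_b dot_zvec !dot0 !addr0 add0r opprK !dot_delta gb => e.
  exact: e.
- apply/colP => i; have := lagE (zvec 0 0 (delta_mx i 0) 0).
  rewrite lagrangian_slope_v dot_zvec !dot0 addr0 !add0r gv !dot_delta => e.
  have gradE : grad (fun v' => dot xi (Psi X v' *m wpart z)) (vpart z) i 0 =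
      dot xi (Psi 0 (delta_mx i 0) *m wpart z).
    have [_ derE] : is_derive (vpart z) (delta_mx i 0)
        (fun v' => dot xi (Psi X v' *m wpart z) : R)
        (dot xi (Psi 0 (delta_mx i 0) *m wpart z)).
      apply: (is_derive_quadratic (q := 0)) => t.
      have := congr1 (dot xi) (Psi_affine X (vpart z) (delta_mx i 0) t (wpart z)).
      by rewrite dotD dotZ mulr0 addr0.
    by rewrite mxE; exact: derE.
  have entryE (a b c r : 'cV[R]_(vdim L N d)) :
      a i 0 - b i 0 - c i 0 - r i 0 = 0 ->
      (0 : 'cV[R]_(vdim L N d)) i 0 = (a - b - c - r) i 0.
    by move=> e0; rewrite !mxE e0.
  apply: entryE; rewrite gradE grad_Obar.
  have -> : (mu1 - shift1) i 0 = mu1 i 0 - shift1 i 0 by rewrite !mxE.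
  have -> : (mu2 - shift2) i 0 = mu2 i 0 - shift2 i 0 by rewrite !mxE.
  have shiftE : shift1 i 0 + shift2 i 0 = B i 0.
    by rewrite !mxE; case: eqP; rewrite ?addr0 ?add0r.
  move: e shiftE; rewrite -/B.
  move: (Obar_slope _ _ _ _ _) (dot xi _) (B i 0) (shift1 i 0) (shift2 i 0)
    (mu1 i 0) (mu2 i 0) => a b c s1 s2 m1 m2.
  by lra.
- apply/colP => i; have := lagE (zvec 0 0 0 (delta_mx i 0)).
  rewrite lagrangian_slope_u dot_zvec !dot0 !add0r !dot_delta => e.
  have -> : (mu1 - shift1 + alpha *: (mu2 - shift2) + xi) i 0 =
      mu1 i 0 - shift1 i 0 + alpha * (mu2 i 0 - shift2 i 0) + xi i 0.
    by rewrite !mxE.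
  have shiftE : shift1 i 0 + alpha * shift2 i 0 = - upart g i 0.
    rewrite [shift1 _ _]mxE [shift2 _ _]mxE.
    case: eqP => [->|gB]; first by rewrite mulr0 addr0 opprK.
    by case: (gu i) => -[_ gE]; [case: gB|rewrite gE opprK add0r].
  rewrite mxE mulrBr; move: e shiftE.
  move: (alpha * mu2 i 0) (alpha * shift2 i 0) (upart g i 0) (shift1 i 0)
    (mu1 i 0) (xi i 0) => a b c s1 m1 x.
  by lra.
split; rewrite /dot big1 // => i _.
  have -> : (mu1 - shift1) i 0 * (vpart z - upart z) i 0 =
      mu1 i 0 * slack alpha (inl i) z - shift1 i 0 * (vpart z i 0 - upart z i 0).
    by rewrite [slack _ _ _]/= !mxE mulrBl.
  rewrite c1 sub0r mxE; case: eqP => [gB|_]; last by rewrite mul0r oppr0.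
  have [u_ge0|u_lt0] := leP 0 (upart z i 0).
    by rewrite vE leaky_pos // subrr mulr0 oppr0.
  exfalso; case: (gu i) => -[u0 gE]; first by move: u0; rewrite leNgt u_lt0.
  have aB : alpha * B i 0 < B i 0 by rewrite gtr_pMl ?B0.
  by move: gB; rewrite gE -/B => /oppr_inj e; rewrite e ltxx in aB.
have -> : (mu2 - shift2) i 0 * (vpart z - alpha *: upart z) i 0 =
    mu2 i 0 * slack alpha (inr i) z -
    shift2 i 0 * (vpart z i 0 - alpha * upart z i 0).
  by rewrite [slack _ _ _]/= !mxE mulrBl.
rewrite c2 sub0r mxE; case: eqP => [_|gB]; first by rewrite mul0r oppr0.
case: (gu i) => -[u0 gE]; first by case: gB.
by rewrite vE leaky_neg // subrr mulr0 oppr0.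
Qed.
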